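(* Let $T$ be a quaternionic torus. The group $Aut(T)$ of biregular automorphisms of $T$ is isomorphic to the group $2D_4$ if and only if there exist $I,J\in\mathbb S$ with $J\perp I$ such that the point $(I,J,JI)$ is (a representative of) the modulus of $T$.
   Context: $\mathbb H\cong\mathbb R^4$ is the skew field of quaternions with its Euclidean scalar product $\langle\cdot,\cdot\rangle$ and norm $|\cdot|$; $\mathbb S=\{q\in\mathbb H: q^2=-1\}$, $\mathbb S^3=\{q\in\mathbb H:|q|=1\}$. A function $f:\Omega\to\mathbb H$ on a domain $\Omega\subseteq\mathbb H$ is (slice) regular if for every $I\in\mathbb S$ its restriction $f_I$ to $\Omega\cap(\mathbb R+I\mathbb R)$ has continuous derivatives and $\frac12\left(\frac{\partial}{\partial x}+I\frac{\partial}{\partial y}\right)f_I(x+Iy)=0$. A rank-4 lattice in $\mathbb H$ is the additive subgroup generated by four $\mathbb R$-linearly independent elements. A quaternionic torus is a quotient $T=\mathbb H/L$, $L$ a rank-4 lattice, with the atlas of local inverses of the projection $\pi:\mathbb H\to\mathbb H/L$ on small connected open sets. A map between two quaternionic tori is regular if its expressions in these charts are slice regular; a biregular diffeomorphism is a bijective regular map with regular inverse. Two tori are equivalent if there is a biregular diffeomorphism of one onto the other. For $T=\mathbb H/L$, $Aut(T)$ is the group (under composition) of maps $F(q)=qa$ with $a\in\mathbb S^3$ and $F(L)=L$. The Gram matrix of an (ordered) basis $\{v_1,v_2,v_3,v_4\}$ of a rank-4 lattice is $(\langle v_i,v_j\rangle)_{i,j}$. A Gram matrix $R=(r_{i,j})$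 is reduced (in the sense of Minkowski–Siegel) if and only if: B1) $r_{k,k+1}\ge 0$ for $k=1,2,3$; B2) for each $k=1,2,3,4$, $n R\,{}^tn\ge r_{k,k}$ for every $n=(n_1,n_2,n_3,n_4)\in\mathbb Z^4$ such that $\gcd(n_k,\dots,n_4)=1$. A special basis is a basis whose Gram matrix is reduced and whose first element is $1$. $\mathcal M=\{(v_2,v_3,v_4)\in\mathbb H^3:\{1,v_2,v_3,v_4\}\text{ is a special basis}\}$. A triple $(v_2,v_3,v_4)$ is (a representative of) the modulus of $T$ if $(v_2,v_3,v_4)\in\mathcal M$ and $T$ is equivalent to $\mathbb H/(\mathbb Z+\mathbb Zv_2+\mathbb Zv_3+\mathbb Zv_4)$. $2D_4$ is the group of order $8$ $\{\pm1,\pm I,\pm J,\pm IJ\}\subset\mathbb S^3$ generated by two orthogonal elements $I,J\in\mathbb S$ (the quaternion group). *)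

(* Defs.v *)
From HB Require Import structures.
From mathcomp Require Import all_boot all_order all_algebra.
From mathcomp Require Import ring.
From mathcomp Require Import all_classical all_reals all_analysis.

Set Implicit Arguments.
Unset Strict Implicit.
Unset Printing Implicit Defensive.

Import Order.TTheory GRing.Theory Num.Theory.
Import numFieldNormedType.Exports.

Local Open Scope classical_set_scope.
Local Open Scope ring_scope.
Local Open Scope quotient_scope.

(* x0 + x1 i + x2 j + x3 k is the row vector (x0, x1, x2, x3), with the topology
   and real vector space structure of 'rV[R]_4. The norm `|q| inherited from
   'rV[R]_4 is the sup norm, NOT the Euclidean norm, which is [qnorm] below;
   both induce the same topology. *)
Definition quat (R : realType) : Type := 'rV[R]_4.

HB.instance Definition _ (R : realType) :=
  NormedModule.copy (quat R) 'rV[R]_4.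
HB.instance Definition _ (R : realType) := Complete.copy (quat R) 'rV[R]_4.
HB.instance Definition _ (R : realType) := Vector.copy (quat R) 'rV[R]_4.

Section Quaternions.
Variable R : realType.
Implicit Types p q : quat R.

Definition mkquat (a b c d : R) : quat R :=
  \row_(k < 4) [:: a; b; c; d]`_k.

Definition re q : R := q 0 (inord 0).
Definition im_i q : R := q 0 (inord 1).
Definition im_j q : R := q 0 (inord 2).
Definition im_k q : R := q 0 (inord 3).

Definition qone : quat R := mkquat 1 0 0 0.

Definition qmul p q : quat R :=
  mkquat
    (re p * re q - im_i p * im_i q - im_j p * im_j q - im_k p * im_k q)
    (re p * im_i q + im_i p * re q + im_j p * im_k q - im_k p * im_j q)
    (re p * im_j q - im_i p * im_k q + im_j p * re q + im_k p * im_i q)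
    (re p * im_k q + im_i p * im_j q - im_j p * im_i q + im_k p * re q).

Lemma mkquatE a b c d :
  (re (mkquat a b c d) = a) * (im_i (mkquat a b c d) = b) *
  (im_j (mkquat a b c d) = c) * (im_k (mkquat a b c d) = d).
Proof. by rewrite /re /im_i /im_j /im_k !mxE !inordK. Qed.

Lemma quatP p q :
  re p = re q -> im_i p = im_i q -> im_j p = im_j q -> im_k p = im_k q -> p = q.
Proof.
move=> h0 h1 h2 h3; apply/rowP => k.
rewrite -[k]inord_val; case: k => -[|[|[|[|//]]]] ? /=; by [].
Qed.

Lemma quatD p q :
  (re (p + q) = re p + re q) * (im_i (p + q) = im_i p + im_i q) *
  (im_j (p + q) = im_j p + im_j q) * (im_k (p + q) = im_k p + im_k q).
Proof. by rewrite /re /im_i /im_j /im_k !mxE. Qed.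

Lemma quatZ (a : R) q :
  (re (a *: q) = a * re q) * (im_i (a *: q) = a * im_i q) *
  (im_j (a *: q) = a * im_j q) * (im_k (a *: q) = a * im_k q).
Proof. by rewrite /re /im_i /im_j /im_k !mxE. Qed.

Lemma qmulA : associative qmul.
Proof. by move=> p q r; apply: quatP; rewrite /qmul !mkquatE; ring. Qed.

Lemma qmul1 : left_id qone qmul.
Proof. by move=> p; apply: quatP; rewrite /qmul !mkquatE; ring. Qed.

Lemma qmulr1 : right_id qone qmul.
Proof. by move=> p; apply: quatP; rewrite /qmul !mkquatE; ring. Qed.

Lemma qmulDl : left_distributive qmul +%R.
Proof.
by move=> p q r; apply: quatP; rewrite quatD /qmul !mkquatE !quatD; ring.
Qed.

Lemma qmulDr : right_distributive qmul +%R.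
Proof.
by move=> p q r; apply: quatP; rewrite quatD /qmul !mkquatE !quatD; ring.
Qed.

Lemma qone_neq0 : qone != 0.
Proof.
apply/eqP => /(congr1 re); rewrite mkquatE /re mxE => /eqP.
by rewrite oner_eq0.
Qed.

HB.instance Definition _ := GRing.Zmodule_isNzRing.Build (quat R)
  qmulA qmul1 qmulr1 qmulDl qmulDr qone_neq0.

Lemma qmulE p q : p * q = qmul p q. Proof. by []. Qed.

Lemma qscaleAl (a : R) p q : a *: (p * q) = (a *: p) * q.
Proof. by apply: quatP; rewrite !qmulE /qmul quatZ !mkquatE !quatZ; ring. Qed.

Lemma qscaleAr (a : R) p q : a *: (p * q) = p * (a *: q).
Proof. by apply: quatP; rewrite !qmulE /qmul quatZ !mkquatE !quatZ; ring. Qed.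

HB.instance Definition _ := GRing.Lmodule_isLalgebra.Build R (quat R) qscaleAl.
HB.instance Definition _ := GRing.Lalgebra_isAlgebra.Build R (quat R) qscaleAr.

Definition qdot p q : R := \sum_(k < 4) p 0 k * q 0 k.
Definition qnorm q : R := Num.sqrt (qdot q q).

Definition imag_units : set (quat R) := [set q | q ^+ 2 = -1].
Definition sphere3 : set (quat R) := [set q | qnorm q = 1].

End Quaternions.

Section SliceRegular.
Variable R : realType.

Definition slice_pt (I : quat R) (z : R * R) : quat R := z.1%:A + z.2 *: I.

(* The partial derivatives d/dx and d/dy of f_I (x + I y) are the directional
   derivatives along (1, 0) and (0, 1) in the plane of the pairs (x, y). *)
Definition slice_regular (Omega : set (quat R)) (f : quat R -> quat R) : Prop :=
  forall I, imag_units I ->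
  let f_I := f \o slice_pt I in
  forall z : R * R, Omega (slice_pt I z) ->
    [/\ derivable f_I z (1, 0) /\ derivable f_I z (0, 1),
        {for z, continuous ('D_(1, 0) f_I)},
        {for z, continuous ('D_(0, 1) f_I)} &
        2^-1 *: ('D_(1, 0) f_I z + I * 'D_(0, 1) f_I z) = 0].

End SliceRegular.

Section Lattices.
Variable R : realType.

Definition zspan (v : 4.-tuple (quat R)) : set (quat R) :=
  [set q | exists n : 'I_4 -> int, q = \sum_(i < 4) tnth v i *~ n i].

Definition lattice_basis (L : set (quat R)) (v : 4.-tuple (quat R)) : Prop :=
  free v /\ L = zspan v.

Record lattice : Type := Lattice {
  lattice_set :> set (quat R);
  latticeP : exists v, lattice_basis lattice_set v }.

Variable L : lattice.

Lemma lattice0 : lattice_set L 0.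
Proof.
have [v [_ ->]] := latticeP L.
by exists (fun=> 0); rewrite big1 // => i _; rewrite mulr0z.
Qed.

Lemma latticeB x y : lattice_set L x -> lattice_set L y -> lattice_set L (x - y).
Proof.
have [v [_ ->]] := latticeP L => -[m ->] [n ->].
exists (fun i => m i - n i); rewrite -sumrB.
by apply: eq_bigr => i _; rewrite mulrzBr.
Qed.

Definition lattice_eq (x y : quat R) : bool := `[< lattice_set L (x - y) >].

Lemma lattice_eq_refl : reflexive lattice_eq.
Proof. by move=> x; apply/asboolP; rewrite subrr; exact: lattice0. Qed.

Lemma lattice_eq_sym : symmetric lattice_eq.
Proof.
by move=> x y; apply/asboolP/asboolP => /(latticeB lattice0); rewrite sub0r opprB.
Qed.

Lemma lattice_eq_trans : transitive lattice_eq.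
Proof.
move=> y x z /asboolP xy /asboolP yz; apply/asboolP.
have /(latticeB lattice0) : lattice_set L (z - y).
  by have := latticeB lattice0 yz; rewrite sub0r opprB.
by rewrite sub0r opprB => /(latticeB lattice0);
  rewrite sub0r => /(latticeB xy); rewrite opprK addrA subrK.
Qed.

Canonical lattice_equiv :=
  EquivRel lattice_eq lattice_eq_refl lattice_eq_sym lattice_eq_trans.

Definition torus : Type := quotient_topology {eq_quot lattice_equiv}.
HB.instance Definition _ := Topological.on torus.
HB.instance Definition _ := Quotient.on torus.

Definition torus_proj (q : quat R) : torus := \pi_torus q.

End Lattices.

Section Tori.
Variable R : realType.
Implicit Types L M : lattice R.

Definition chart_dom L (V : set (quat R)) : Prop :=
  [/\ open V, connected V & {in V &, injective (@torus_proj R L)}].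

(* The inverse of the projection V -> pi(V); 0 outside of pi(V). *)
Definition chart L (V : set (quat R)) (t : torus L) : quat R :=
  xget 0 [set q | V q /\ torus_proj L q = t].

(* The second condition reads F in the charts attached to V and W: the
   expression of F is defined at the q in V such that F (pi q) is in pi(W).
   Continuity of F makes this set of points open. *)
Definition torus_regular L M (F : torus L -> torus M) : Prop :=
  continuous F /\
  forall V W, chart_dom L V -> chart_dom M W ->
    slice_regular
      (V `&` [set q | (torus_proj M @` W) (F (torus_proj L q))])
      (fun q => chart W (F (torus_proj L q))).

Definition torus_equiv L M : Prop :=
  exists (F : torus L -> torus M) (G : torus M -> torus L),
    [/\ cancel F G, cancel G F, torus_regular F & torus_regular G].

(* Aut(H / L), acting on H / L: the self-maps induced by the q |-> q a. Distinct
   a induce distinct maps. *)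
Definition torus_aut L : set (torus L -> torus L) :=
  [set F | exists a : quat R,
    [/\ sphere3 a, [set q * a | q in L] = L &
        forall q, F (torus_proj L q) = torus_proj L (q * a)]].

Definition gram (v : 4.-tuple (quat R)) : 'M[R]_4 :=
  \matrix_(i, j) qdot (tnth v i) (tnth v j).

Definition reduced (A : 'M[R]_4) : Prop :=
  (forall i j : 'I_4, j = i.+1 :> nat -> 0 <= A i j) /\
  (forall (k : 'I_4) (n : 'rV[int]_4),
     \big[gcdz/0]_(i < 4 | (k <= i)%N) n 0 i = 1 ->
     let nR : 'rV[R]_4 := map_mx intr n in
     A k k <= (nR *m A *m nR^T) 0 0).

Definition special_basis (v : 4.-tuple (quat R)) : Prop :=
  [/\ free v, tnth v ord0 = 1 & reduced (gram v)].

Definition basis1 (t : quat R * quat R * quat R) : 4.-tuple (quat R) :=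
  [tuple 1; t.1.1; t.1.2; t.2].

Definition moduli : set (quat R * quat R * quat R) :=
  [set t | special_basis (basis1 t)].

Definition is_modulus L (t : quat R * quat R * quat R) : Prop :=
  moduli t /\
  exists M : lattice R, M = zspan (basis1 t) :> set (quat R) /\ torus_equiv L M.

End Tori.

Arguments torus_aut {R} L.

Definition group_isom (A B : Type) (G : set A) (mulA : A -> A -> A)
    (H : set B) (mulB : B -> B -> B) : Prop :=
  exists phi : A -> B, set_bij G H phi /\
    forall x y, G x -> G y -> phi (mulA x y) = mulB (phi x) (phi y).

Definition twoD4 (R : realType) (I J : quat R) : set (quat R) :=
  [set 1; -1; I; -I; J; -J; I * J; - (I * J)].

(* Main.v *)
Require Import Defs.
From mathcomp Require Import all_boot all_order all_algebra.
From mathcomp Require Import ring lra zify.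
From mathcomp Require Import all_classical all_reals all_analysis.

Set Implicit Arguments.
Unset Strict Implicit.
Unset Printing Implicit Defensive.

Import Order.TTheory GRing.Theory Num.Theory.
Import numFieldNormedType.Exports.

Local Open Scope classical_set_scope.
Local Open Scope ring_scope.

(** Let U(L) be the group of the quaternions a of norm 1 with L a = L. Each map
    q |-> q a with a in U(L) acts on H / L, distinct a act differently, and
    composing maps multiplies the quaternions in the opposite order, so the
    group Aut(H / L) is the opposite of U(L) ([torus_aut_isomP]). Both sides of
    the equivalence are thus statements about U(L).

    Equivalent tori have right-proportional lattices, M = L a
    ([torus_equiv_lattice]). A biregular F : H / L -> H / M lifts to a continuous
    f : H -> H, built by adding up small increments of F along dyadic
    subdivisions of the segments from 0 ([lift_exists]). For l in L the
    difference f (q + l) - f q lies in the discrete set M, so it does not depend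
    on q; hence f stays at bounded distance from a real linear map A
    ([lift_linear_part]). On a slice R + I R the lift f satisfies the
    Cauchy-Riemann equation, so its integral along the boundary of a square of
    side N vanishes. The part of that integral due to A is N^2 (A 1 + I (A I))
    up to a factor, while the bounded part f - A contributes only O(N).
    Therefore A 1 + I (A I) = 0, which says A I = I (A 1); applied to I = i, j, k
    this makes A a right multiplication. Cauchy's theorem is used in a discrete
    form ([locally_cr_grid]): increments over a fine square grid telescope, and
    compactness makes the Cauchy-Riemann error uniformly small, so no integral
    is needed.

    If (I, J, J I) is a modulus, then U(L) is conjugate to U(M), where M consists
    of the integral combinations of 1, I, J, I J. As 1 belongs to M, a unit of M
    is an element of M of norm 1, so it is one of the eight elements of
    {1, -1, I, -I, J, -J, I J, - I J} ([twoD4_frame]). Quaternionic conjugation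
    repairs the reversal of products ([modulus_anti_isom]).

    If Aut(H / L) is the quaternion group, then U(L) contains a, b with
    a^2 = b^2 = -1 and b a = - a b. Scale L on the right by the inverse of a
    shortest vector m: the new lattice N has minimal norm 1, contains 1, and is
    stable under right multiplication by I = m a m^-1 and J = m b m^-1. So N
    contains the Lipschitz lattice spanned by 1, I, J, I J. Rounding the
    coordinates of a point of N leaves a remainder with coordinates in
    [-1/2, 1/2), of squared norm at most 1; minimality forces it to be 0 or to
    have all coordinates equal to -1/2. Hence N is the Lipschitz lattice or the
    Hurwitz lattice ([frame_module_cases]). The Hurwitz lattice has the unit
    (1 + I + J + I J) / 2, of order 6, whereas every element of the quaternion
    group has order dividing 4. So N is the Lipschitz lattice
    ([anticommuting_units_modulus]). *)

(** * Quaternion algebra and orthonormal frames *)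

Section QuaternionAlgebra.
Variable R : realType.
Implicit Types p q x y I J : quat R.

Lemma re1 : (re (1 : quat R) = 1) * (im_i (1 : quat R) = 0) *
  (im_j (1 : quat R) = 0) * (im_k (1 : quat R) = 0).
Proof. exact: mkquatE. Qed.

Lemma re0 : (re (0 : quat R) = 0) * (im_i (0 : quat R) = 0) *
  (im_j (0 : quat R) = 0) * (im_k (0 : quat R) = 0).
Proof. by rewrite /re /im_i /im_j /im_k !mxE. Qed.

Lemma quatN q : (re (- q) = - re q) * (im_i (- q) = - im_i q) *
  (im_j (- q) = - im_j q) * (im_k (- q) = - im_k q).
Proof. by rewrite /re /im_i /im_j /im_k !mxE. Qed.

Lemma quatM p q :
  (re (p * q) = re p * re q - im_i p * im_i q - im_j p * im_j q - im_k p * im_k q) *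
  (im_i (p * q) = re p * im_i q + im_i p * re q + im_j p * im_k q - im_k p * im_j q) *
  (im_j (p * q) = re p * im_j q - im_i p * im_k q + im_j p * re q + im_k p * im_i q) *
  (im_k (p * q) = re p * im_k q + im_i p * im_j q - im_j p * im_i q + im_k p * re q).
Proof. exact: mkquatE. Qed.

Definition quatE := (re1, re0, quatD, quatN, quatZ, quatM, mkquatE).

Lemma sum_coords (V : nmodType) (F : 'I_4 -> V) :
  \sum_(k < 4) F k = F (inord 0) + F (inord 1) + F (inord 2) + F (inord 3).
Proof.
rewrite !big_ord_recl big_ord0 addr0 !addrA.
by do 3?[congr (_ + _)]; congr F; apply/val_inj; rewrite /= inordK.
Qed.

Lemma qdotE p q : qdot p q =
  re p * re q + im_i p * im_i q + im_j p * im_j q + im_k p * im_k q.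
Proof. exact: sum_coords. Qed.

Definition qconj q := mkquat (re q) (- im_i q) (- im_j q) (- im_k q).

Lemma qconjE q : (re (qconj q) = re q) * (im_i (qconj q) = - im_i q) *
  (im_j (qconj q) = - im_j q) * (im_k (qconj q) = - im_k q).
Proof. exact: mkquatE. Qed.

Lemma qconjM p q : qconj (p * q) = qconj q * qconj p.
Proof. by apply: quatP; rewrite !(qconjE, quatE); ring. Qed.

Lemma qconjK : involutive qconj.
Proof. by move=> q; apply: quatP; rewrite !qconjE ?opprK. Qed.

Definition normsq q := qdot q q.

Lemma normsqE q : normsq q = re q ^+ 2 + im_i q ^+ 2 + im_j q ^+ 2 + im_k q ^+ 2.
Proof. by rewrite /normsq qdotE -!expr2. Qed.

Lemma normsqM p q : normsq (p * q) = normsq p * normsq q.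
Proof. by rewrite !normsqE !quatE; ring. Qed.

Lemma normsq_conj q : normsq (qconj q) = normsq q.
Proof. by rewrite !normsqE !qconjE; ring. Qed.

Lemma normsq1 : normsq (1 : quat R) = 1.
Proof. by rewrite normsqE !quatE; ring. Qed.

Lemma mul_qconj q : q * qconj q = normsq q *: 1.
Proof. by apply: quatP; rewrite !(quatE, qconjE, normsqE); ring. Qed.

Lemma qconj_mul q : qconj q * q = normsq q *: 1.
Proof. by apply: quatP; rewrite !(quatE, qconjE, normsqE); ring. Qed.

Lemma normsq_ge0 q : 0 <= normsq q.
Proof. by rewrite normsqE !addr_ge0 ?sqr_ge0. Qed.

Lemma normsq_eq0 q : (normsq q == 0) = (q == 0).
Proof.
apply/eqP/eqP => [|->]; last by rewrite normsqE !quatE; ring.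
by rewrite normsqE => h; apply: quatP; rewrite !quatE; nra.
Qed.

Lemma sphere3E q : sphere3 q <-> normsq q = 1.
Proof.
rewrite /sphere3 /= /qnorm -/(normsq q); split => [h|->]; last exact: sqrtr1.
by rewrite -[LHS]sqr_sqrtr ?normsq_ge0// h expr1n.
Qed.

Definition qinv q := (normsq q)^-1 *: qconj q.

Lemma qmul_inv q : q != 0 -> q * qinv q = 1.
Proof.
by move=> q0; rewrite -scalerAr mul_qconj scalerA mulVf ?scale1r ?normsq_eq0.
Qed.

Lemma qinv_mul q : q != 0 -> qinv q * q = 1.
Proof.
by move=> q0; rewrite -scalerAl qconj_mul scalerA mulVf ?scale1r ?normsq_eq0.
Qed.

Lemma qmul_eq0 p q : (p * q == 0) = (p == 0) || (q == 0).
Proof. by rewrite -!normsq_eq0 normsqM mulf_eq0. Qed.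

Lemma imag_unitP I :
  imag_units I <-> re I = 0 /\ im_i I ^+ 2 + im_j I ^+ 2 + im_k I ^+ 2 = 1.
Proof.
rewrite /imag_units /= expr2; split => [h|[h0 h1]].
  have := congr1 (@re R) h; have := congr1 (@im_i R) h.
  have := congr1 (@im_j R) h; have := congr1 (@im_k R) h.
  rewrite !quatE => h3 h2 h1 h0.
  have r0 : re I = 0.
    have [//|rn0] := eqVneq (re I) 0.
    have z c : re I * c + re I * c = 0 -> c = 0.
      by rewrite -mulr2n => /eqP; rewrite mulrn_eq0/= mulf_eq0 (negPf rn0) => /eqP.
    have e1 : im_i I = 0 by apply: z; lra.
    have e2 : im_j I = 0 by apply: z; lra.
    have e3 : im_k I = 0 by apply: z; lra.
    by move: h0; rewrite e1 e2 e3; nra.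
  by split=> //; move: h0; rewrite r0; nra.
by apply: quatP; rewrite !quatE h0 ?mulr0 ?mul0r; nra.
Qed.

Lemma qdotC p q : qdot p q = qdot q p.
Proof. by rewrite !qdotE; ring. Qed.

Lemma imag_unit_anticomm I J : imag_units I -> imag_units J -> qdot I J = 0 ->
  J * I = - (I * J).
Proof.
move=> /imag_unitP[i0 _] /imag_unitP[j0 _]; rewrite qdotE => h.
by apply: quatP; rewrite !quatE; move: h; rewrite i0 j0; lra.
Qed.

Lemma anticomm_orthogonal I J : imag_units I -> imag_units J ->
  J * I = - (I * J) -> qdot I J = 0.
Proof.
move=> /imag_unitP[i0 _] /imag_unitP[j0 _] /(congr1 (@re R)).
by rewrite qdotE !quatE i0 j0; lra.
Qed.

(** The rows 1, I, J, I J form an orthonormal basis, so this matrix is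
    orthogonal: one product of matrices gives at once the isometry, the
    injectivity and the surjectivity of [in_frame]. *)
Definition frame_mx I J : 'M[R]_4 :=
  \matrix_(k < 4) ([:: 1; I; J; I * J] : seq 'rV[R]_4)`_k.

(** The embedding of the quaternions that sends i, j, k to I, J, I J. For
    orthogonal imaginary units it is an algebra automorphism, which transports
    the standard integral quaternions to any frame. *)
Definition in_frame I J x : quat R :=
  re x *: 1 + im_i x *: I + im_j x *: J + im_k x *: (I * J).

Lemma in_frameE I J x : in_frame I J x = (x : 'rV_4) *m frame_mx I J.
Proof.
rewrite mulmx_sum_row sum_coords /in_frame.
by rewrite !rowK !inordK.
Qed.

Lemma qdotM2l q p r : qdot (q * p) (q * r) = normsq q * qdot p r.
Proof. by rewrite normsqE !qdotE !quatE; ring. Qed.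

Lemma qdotM2r q p r : qdot (p * q) (r * q) = normsq q * qdot p r.
Proof. by rewrite normsqE !qdotE !quatE; ring. Qed.

Lemma qdot1 q : qdot 1 q = re q.
Proof. by rewrite qdotE !quatE; ring. Qed.

Lemma imag_unit_normsq I : imag_units I -> normsq I = 1.
Proof. by move=> /imag_unitP[i0 iN]; rewrite normsqE i0; lra. Qed.

Lemma imag_unit_sqr I : imag_units I -> I * I = -1.
Proof. by rewrite /imag_units /= expr2. Qed.

Lemma frame_mx_orthogonal I J : imag_units I -> imag_units J -> qdot I J = 0 ->
  frame_mx I J *m (frame_mx I J)^T = 1%:M.
Proof.
move=> hI hJ hIJ.
have IN := imag_unit_normsq hI; have JN := imag_unit_normsq hJ.
have /imag_unitP[i0 _] := hI; have /imag_unitP[j0 _] := hJ.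
have d1 : qdot 1 (I * J) = 0.
  move: hIJ; rewrite qdot1 qdotE !quatE i0 j0; lra.
have d2 : qdot I (I * J) = 0.
  by rewrite -{1}[I]mulr1 qdotM2l qdot1 j0 mulr0.
have d3 : qdot J (I * J) = 0.
  by rewrite -{1}[J]mul1r qdotM2r qdot1 i0 mulr0.
have d4 : qdot (I * J) (I * J) = 1 by rewrite qdotM2l -/(normsq J) IN JN mulr1.
apply/matrixP => k l; rewrite !mxE.
rewrite (eq_bigr (fun s => (([:: 1; I; J; I * J] : seq (quat R))`_k) 0 s *
   (([:: 1; I; J; I * J] : seq (quat R))`_l) 0 s)); last by move=> s _; rewrite !mxE.
rewrite -[LHS]/(qdot _ _).
case: k => -[|[|[|[|//]]]] ? ; case: l => -[|[|[|[|//]]]] ? /=;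
  by rewrite ?(d1, d2, d3, d4, qdot1, i0, j0, re1, hIJ) // qdotC
    ?(d1, d2, d3, d4, qdot1, i0, j0, re1, hIJ).
Qed.

Lemma in_frameM I J x y : imag_units I -> imag_units J -> qdot I J = 0 ->
  in_frame I J (x * y) = in_frame I J x * in_frame I J y.
Proof.
move=> hI hJ hIJ.
have ii := imag_unit_sqr hI; have jj := imag_unit_sqr hJ.
have ji := imag_unit_anticomm hI hJ hIJ.
have i_ij : I * (I * J) = - J by rewrite mulrA ii mulN1r.
have j_ij : J * (I * J) = I by rewrite mulrA ji mulNr -mulrA jj mulrN1 opprK.
have ij_i : I * J * I = J by rewrite -mulrA ji mulrN i_ij opprK.
have ij_j : I * J * J = - I by rewrite -mulrA jj mulrN1.
have ij_ij : I * J * (I * J) = -1 by rewrite -mulrA j_ij.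
rewrite /in_frame !mulrDl !mulrDr -!scalerAl -!scalerAr !mul1r !mulr1.
rewrite ii jj ji i_ij j_ij ij_i ij_j ij_ij.
move: (I * J) => K.
by apply: quatP; rewrite !(quatD, quatZ, quatN) !quatM !re1; ring.
Qed.

Lemma in_frame1 I J : in_frame I J 1 = 1.
Proof. by rewrite /in_frame !re1 scale1r !scale0r !addr0. Qed.

Lemma in_frameD I J : {morph in_frame I J : x y / x + y}.
Proof. by move=> x y; rewrite !in_frameE mulmxDl. Qed.

Lemma in_frameN I J : {morph in_frame I J : x / - x}.
Proof. by move=> x; rewrite !in_frameE mulNmx. Qed.

Lemma in_frame_normsq I J x : imag_units I -> imag_units J -> qdot I J = 0 ->
  normsq (in_frame I J x) = normsq x.
Proof.
move=> hI hJ hIJ.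
have dotE p q : qdot p q = ((p : 'rV_4) *m (q : 'rV_4)^T) 0 0.
  by rewrite mxE; apply: eq_bigr => i _; rewrite !mxE.
rewrite /normsq !dotE in_frameE trmx_mul mulmxA -(mulmxA (x : 'rV_4)).
by rewrite frame_mx_orthogonal // mulmx1.
Qed.

Definition frame_coords I J y : quat R := (y : 'rV_4) *m (frame_mx I J)^T.

Lemma in_frameK I J : imag_units I -> imag_units J -> qdot I J = 0 ->
  cancel (in_frame I J) (frame_coords I J).
Proof.
move=> hI hJ hIJ x; rewrite /frame_coords in_frameE -mulmxA.
by rewrite frame_mx_orthogonal // mulmx1.
Qed.

Lemma frame_coordsK I J : imag_units I -> imag_units J -> qdot I J = 0 ->
  cancel (frame_coords I J) (in_frame I J).
Proof.
move=> hI hJ hIJ x; rewrite /frame_coords in_frameE -mulmxA.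
by rewrite (mulmx1C (frame_mx_orthogonal hI hJ hIJ)) mulmx1.
Qed.

End QuaternionAlgebra.

(** * Rank four lattices: discreteness, cocompactness, shortest vectors *)

Section Lattices.
Variable R : realType.
Implicit Types (L : lattice R) (q x y : quat R).

Lemma latticeN L x : lattice_set L x -> lattice_set L (- x).
Proof. by move=> /(latticeB (lattice0 L)); rewrite sub0r. Qed.

Lemma latticeD L x y :
  lattice_set L x -> lattice_set L y -> lattice_set L (x + y).
Proof. by move=> hx /latticeN hy; rewrite -[y]opprK; exact: latticeB. Qed.

Lemma lattice_sum L (I : Type) (r : seq I) (P : pred I) (F : I -> quat R) :
  (forall i, P i -> lattice_set L (F i)) ->
  lattice_set L (\sum_(i <- r | P i) F i).
Proof.
by move=> h; elim/big_ind: _ => //; [exact: lattice0|exact: latticeD].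
Qed.

Lemma latticeMz L x (n : int) : lattice_set L x -> lattice_set L (x *~ n).
Proof.
move=> hx; have hn (k : nat) : lattice_set L (x *+ k).
  elim: k => [|k IH]; first by rewrite mulr0n; exact: lattice0.
  by rewrite mulrS; exact: latticeD.
by case: n => k; [exact: hn|rewrite NegzE mulrNz; apply: latticeN; exact: hn].
Qed.

Lemma torus_projP L x y :
  torus_proj L x = torus_proj L y <-> lattice_set L (x - y).
Proof.
by split=> [/(@eqmodP _ (lattice_equiv L))/asboolP|
  /asboolP/(@eqmodP _ (lattice_equiv L))].
Qed.

Lemma torus_proj_surj L (t : torus L) : exists q, torus_proj L q = t.
Proof. by exists (repr t); exact: reprK. Qed.

Lemma coord_le q i : `|q 0 i| <= `|q|.
Proof.
rewrite [leRHS]/Num.Def.normr/= mx_normrE.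
exact: (le_bigmax _ (fun ij => `|q ij.1 ij.2|) (0, i)).
Qed.

Lemma norm_leP q (C : R) : 0 <= C -> (forall i, `|q 0 i| <= C) -> `|q| <= C.
Proof.
move=> C0 h; rewrite [leLHS]/Num.Def.normr/= mx_normrE.
by apply: bigmax_le => // -[i j] _ /=; rewrite ord1.
Qed.

Lemma mulmx_bound (A : 'M[R]_4) : exists2 C, 0 < C &
  forall q : quat R, `|(q : 'rV_4) *m A : quat R| <= C * `|q|.
Proof.
exists (1 + \sum_i \sum_j `|A i j|).
  by rewrite ltr_pwDl // sumr_ge0 // => i _; rewrite sumr_ge0.
move=> q; apply: norm_leP => [|j].
  by rewrite mulr_ge0// addr_ge0// sumr_ge0 // => i _; rewrite sumr_ge0.
rewrite mxE (le_trans (ler_norm_sum _ _ _))//.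
rewrite mulrDl mul1r mulr_suml ler_wpDl//; apply: ler_sum => i _.
rewrite normrM mulrC ler_pM ?coord_le//.
by rewrite (bigD1 j)//= lerDl sumr_ge0.
Qed.

Lemma normsq_ge_sup q : `|q| ^+ 2 <= normsq q.
Proof.
have s i : `|q 0 i| ^+ 2 <= normsq q.
  rewrite /normsq /qdot (bigD1 i)//= real_normK ?num_real// expr2 lerDl sumr_ge0 // => j _.
  by rewrite -expr2 sqr_ge0.
rewrite -[leRHS]sqr_sqrtr ?normsq_ge0// lerXn2r ?nnegrE ?sqrtr_ge0//.
apply: norm_leP; rewrite ?sqrtr_ge0// => i.
by rewrite -(ler_pXn2r (n := 2)) ?nnegrE ?sqrtr_ge0// sqr_sqrtr ?normsq_ge0.
Qed.

Lemma qmul_bound x q : `|q * x| <= 4 * `|q| * `|x|.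
Proof.
apply: norm_leP => [|i]; first by rewrite !mulr_ge0.
have b (k l : 'I_4) : `|q 0 k * x 0 l| <= `|q| * `|x|.
  by rewrite normrM ler_pM ?coord_le.
have b4 (c d e f : R) : `|c| <= `|q| * `|x| -> `|d| <= `|q| * `|x| ->
    `|e| <= `|q| * `|x| -> `|f| <= `|q| * `|x| ->
    `|c + d + e + f| <= 4 * `|q| * `|x|.
  have := ler_normD (c + d + e) f; have := ler_normD (c + d) e.
  by have := ler_normD c d; rewrite -mulrA; lra.
rewrite -[i]inord_val; case: i => -[|[|[|[|//]]]] ? /=;
  rewrite -?[_ 0 (inord 0)]/(re _) -?[_ 0 (inord 1)]/(im_i _)
   -?[_ 0 (inord 2)]/(im_j _) -?[_ 0 (inord 3)]/(im_k _) quatM;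
  by apply: b4; rewrite ?normrN b.
Qed.

(** In coordinates with respect to a basis the lattice is the set of integral
    row vectors; the metric properties below come from the boundedness of the
    two changes of coordinates. *)
Lemma lattice_mxP L : exists2 V : 'M[R]_4, V \in unitmx &
  forall q, lattice_set L q <->
    exists n : 'I_4 -> int, (q : 'rV_4) = (\row_i (n i)%:~R) *m V.
Proof.
have [v [fv Lv]] := latticeP L.
exists (\matrix_(i < 4) (tnth v i : 'rV_4)).
  rewrite -row_free_unit -kermx_eq0; apply/rowV0P => u /sub_kermxP.
  rewrite mulmx_sum_row => u0.
  move/freeP: fv => /(_ (fun i => u 0 i)) fv.
  apply/rowP => i; rewrite mxE; apply: fv.
  by rewrite -[RHS]u0; apply: eq_bigr => j _; rewrite rowK (tnth_nth 0).
move=> q; rewrite Lv; split=> -[n ->]; exists n.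
  by rewrite mulmx_sum_row; apply: eq_bigr => j _; rewrite rowK mxE scaler_int.
by rewrite mulmx_sum_row; apply: eq_bigr => j _; rewrite rowK mxE scaler_int.
Qed.

Lemma lattice_discrete L : exists2 d : R, 0 < d &
  forall q, lattice_set L q -> `|q| < d -> q = 0.
Proof.
have [V Vu hV] := lattice_mxP L.
have [C C0 hC] := mulmx_bound (invmx V).
exists C^-1; first by rewrite invr_gt0.
move=> q /hV[n qn] qd.
have nq : \row_i (n i)%:~R = (q : 'rV_4) *m invmx V by rewrite qn mulmxK.
have n0 i : n i = 0.
  have : `|(n i)%:~R : R| < 1.
    apply: (@le_lt_trans _ _ (C * `|q|)); last first.
      by rewrite mulrC -ltr_pdivlMr// mul1r.
    apply: le_trans (hC q); rewrite -nq.
    by apply: le_trans (coord_le _ i); rewrite mxE.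
  rewrite -intr_norm -[1]/(1%:~R) ltr_int; lia.
rewrite qn (_ : \row_i _ = 0) ?mul0mx//.
by apply/rowP => i; rewrite !mxE n0.
Qed.

Lemma lattice_cocompact L : exists2 C : R, 0 < C &
  forall q, exists2 l, lattice_set L l & `|q - l| <= C.
Proof.
have [V Vu hV] := lattice_mxP L.
have [C C0 hC] := mulmx_bound V.
exists C => // q; pose t := (q : 'rV_4) *m invmx V.
exists ((\row_i (Num.floor (t 0 i))%:~R) *m V).
  by apply/hV; exists (fun i => Num.floor (t 0 i)).
have -> : q - (\row_i (Num.floor (t 0 i))%:~R) *m V =
    (t - \row_i (Num.floor (t 0 i))%:~R) *m V.
  by rewrite mulmxBl mulmxKV.
apply: le_trans (hC _) _; rewrite -[leRHS]mulr1 ler_pM2l//.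
move: t => t; apply: norm_leP => // i; rewrite !mxE.
have h1 := floor_le (t 0 i); have h2 := floorD1_gt (t 0 i).
move: h2; rewrite intrD => h2.
by rewrite ger0_norm ?subr_ge0//; lra.
Qed.

(** The vectors no longer than a given one have bounded integral coordinates, so
    a shortest one is found in a finite set. *)
Lemma lattice_min_vector L : exists m,
  [/\ lattice_set L m, m != 0 &
      forall l, lattice_set L l -> l != 0 -> normsq m <= normsq l].
Proof.
have [V Vu hV] := lattice_mxP L.
have [C C0 hC] := mulmx_bound (invmx V).
pose vec (n : 'I_4 -> int) : quat R := (\row_i (n i)%:~R) *m V.
have vecL n : lattice_set L (vec n) by apply/hV; exists n.
have vec0 n : vec n = 0 -> forall i, n i = 0.
  move=> /(congr1 (mulmx^~ (invmx V))); rewrite mulmxK// mul0mx => h i.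
  by have /rowP/(_ i) := h; rewrite !mxE => /eqP; rewrite intr_eq0 => /eqP.
pose l0 := vec (fun=> 1).
have l00 : l0 != 0 by apply/eqP => /vec0/(_ 0).
pose B := Num.truncn (C * (normsq l0 + 1)).
have coordB l (n : 'I_4 -> int) : (l = vec n) -> normsq l <= normsq l0 ->
    forall i, (`|n i| <= B)%N.
  move=> ln lN i.
  have nl : \row_i (n i)%:~R = (l : 'rV_4) *m invmx V by rewrite ln mulmxK.
  rewrite /B truncn_ge_nat; last first.
    by rewrite mulr_ge0 ?ltW// ltr_wpDl ?normsq_ge0.
  rewrite natr_absz intr_norm.
  apply: (@le_trans _ _ (C * `|l|)).
    apply: le_trans (hC l); rewrite -nl.
    by apply: le_trans (coord_le _ i); rewrite mxE.
  rewrite ler_pM2l//.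
  have := normsq_ge_sup l; have := normsq_ge0 l; have := normr_ge0 l; nra.
(* Coordinates in [-B, B] are encoded as ordinals shifted by B. *)
pose dec (f : {ffun 'I_4 -> 'I_(B + B).+1}) := vec (fun i => (f i)%:Z - B%:Z).
have decP l : lattice_set L l -> normsq l <= normsq l0 -> exists f, l = dec f.
  move=> /hV[n ln] lN; have nB := coordB _ _ ln lN.
  exists [ffun i => inord (absz (n i + B%:Z))]; rewrite /dec ln.
  congr (_ *m _); apply/rowP => i; rewrite !mxE ffunE; congr (_%:~R).
  by have := nB i => ?; rewrite inordK; lia.
have [f0 f0E] := decP l0 (vecL _) (lexx _).
have f0n : dec f0 != 0 by rewrite -f0E.
case: (@arg_minP _ R _ f0 (fun f => dec f != 0) (fun f => normsq (dec f)) f0n) => f fn fmin.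
exists (dec f); split=> // [|l lL ln0]; first exact: vecL.
have [lN|/ltW lN] := leP (normsq l) (normsq l0).
  by have [g lg] := decP _ lL lN; rewrite lg; apply: fmin; rewrite -lg.
by apply: le_trans lN; rewrite f0E; apply: fmin.
Qed.

End Lattices.

(** * A discrete form of Cauchy's theorem *)

Section DiscreteCauchy.
Variable R : realType.

Lemma derive_line (V : normedModType R) (h : V -> quat R) (z v : V) (t : R) i :
  derivable h (z + t *: v) v ->
  is_derive t (1 : R) (fun s : R => h (z + s *: v) 0 i) ('D_v h (z + t *: v) 0 i).
Proof.
move=> hd; have hd' : derivable (fun x => h x 0 i) (z + t *: v) v.
  by have /derivable_mxP := hd; apply.
have E : (fun s : R => s^-1 *:
     (((fun s : R => h (z + s *: v) 0 i) \o shift t) (s *: (1 : R)) -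
      h (z + t *: v) 0 i)) =
   (fun s : R => s^-1 *:
     (((fun x => h x 0 i) \o shift (z + t *: v)) (s *: v) - h (z + t *: v) 0 i)).
  apply/funext => s /=; congr (_ *: (h _ 0 i - _)).
  by rewrite -[s%:A]/(s * 1) mulr1 scalerDl addrCA.
split; first by rewrite /derivable E; exact: hd'.
by rewrite (derive_mx hd) mxE /derive E.
Qed.

(** The mean value theorem along v, applied to each coordinate. The estimate is
    uniform in z near z0 because the directional derivative is continuous; this
    uniformity is what compactness arguments need. *)
Lemma increment_estimate (V : normedModType R) (h : V -> quat R) (z0 v : V) :
  (\forall z \near z0, derivable h z v) -> {for z0, continuous ('D_v h)} ->
  forall d : R, 0 < d -> \forall z \near z0 & e \near 0^'+,
    `|h (z + e *: v) - h z - e *: 'D_v h z0| <= d * e.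
Proof.
move=> hd hc d d0.
have hn : \forall z \near z0, derivable h z v /\ `|'D_v h z0 - 'D_v h z| <= d.
  near=> z; split; first by near: z.
  by near: z; move/cvgrPdist_le : hc; apply.
have /nbhs_ballP[r /= r0 hr] := hn.
exists (ball z0 (r / 2), [set e : R | 0 < e /\ e * `|v| < r / 2]).
  split=> /=; first by apply: nbhsx_ballx; rewrite divr_gt0.
  near=> e; split=> //.
  have : e * (`|v| + 1) < r / 2.
    rewrite -ltr_pdivlMr ?ltr_wpDl//; near: e; apply: nbhs_right_lt.
    by rewrite !divr_gt0// ltr_wpDl.
  by apply: le_lt_trans; rewrite ler_wpM2l// lerDl.
move=> [z e] /= [zr [e0 er]].
have inb t : 0 <= t <= e -> ball z0 r (z + t *: v).
  move=> /andP[t0 te]; rewrite -ball_normE /ball_ /= opprD addrA.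
  rewrite (le_lt_trans (ler_normB _ _))//.
  rewrite (splitr r) ltrD//; first by move: zr; rewrite -ball_normE.
  by rewrite normrZ ger0_norm// (le_lt_trans _ er)// ler_wpM2r.
apply: norm_leP => [|i]; first by rewrite mulr_ge0// ltW.
have [phi phiE] : {phi : R -> R | phi = fun s : R => h (z + s *: v) 0 i}.
  by exists (fun s : R => h (z + s *: v) 0 i).
have [dphi dphiE] : {dphi : R -> R | dphi = fun s : R => 'D_v h (z + s *: v) 0 i}.
  by exists (fun s : R => 'D_v h (z + s *: v) 0 i).
have dl t : t \in `[0, e] -> is_derive t (1 : R) phi (dphi t).
  rewrite in_itv/= phiE dphiE => te; apply: derive_line.
  by have [] := hr _ (inb _ te).
have phic : {within `[0, e], continuous phi}.
  by apply: derivable_within_continuous => t /dl [].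
have phid t : t \in `]0, e[ -> is_derive t (1 : R) phi (dphi t).
  by move=> te; apply: dl; exact: subset_itv_oo_cc te.
have [c ce] := MVT e0 phid phic.
rewrite phiE dphiE {phi phiE dphi dphiE dl phic phid}.
rewrite subr0 scale0r addr0 => hE.
rewrite !mxE hE [e * _]mulrC -mulrBl normrM (ger0_norm (ltW e0)) ler_pM2r//.
have {}ce := subset_itv_oo_cc ce; rewrite in_itv /= in ce.
have [_] := hr _ (inb _ ce); apply: le_trans; rewrite distrC.
by apply: le_trans (coord_le _ i); rewrite !mxE.
Unshelve. all: by end_near. Qed.

(** The Cauchy-Riemann equation d/dx + I d/dy = 0 for difference quotients,
    locally uniformly in the base point. *)
Definition locally_cr (I : quat R) (u : R * R -> quat R) :=
  forall (z0 : R * R) (d : R), 0 < d -> \forall z \near z0 & e \near 0^'+,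
    `|u (z.1 + e, z.2) - u z + I * (u (z.1, z.2 + e) - u z)| <= d * e.

Definition grid_pt (N : R) (n k : nat) : R := k%:R * (N / n%:R).

(** Cauchy's theorem on the square [0, N]^2. On a grid of n^2 cells of side N / n,
    horizontal increments telescope along rows and vertical ones along columns,
    which leaves the boundary; each cell contributes an error of d N / n. *)
Lemma locally_cr_grid I u (N d : R) : locally_cr I u -> 0 < N -> 0 < d ->
  exists2 n : nat, (0 < n)%N &
    `|\sum_(0 <= j < n) (u (N, grid_pt N n j) - u (0, grid_pt N n j)) +
      I * \sum_(0 <= k < n) (u (grid_pt N n k, N) - u (grid_pt N n k, 0))| <= n%:R * N * d.
Proof.
move=> cru N0 d0.
have cK : compact (`[0, N]%classic `*` `[0, N]%classic : set (R * R)).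
  by apply: compact_setX; exact: segment_compact.
have F0 : Filter ((0 : R)^'+) by exact: within_filter.
have := (compact_near_coveringP _).1 cK R (0^'+)
  (fun e z => `|u (z.1 + e, z.2) - u z + I * (u (z.1, z.2 + e) - u z)| <= d * e) F0
  (fun z _ => cru z d d0).
rewrite /= => /nbhs_ballP[r /= r0 hr].
pose n := (Num.truncn (N / r)).+1.
have nr0 : 0 < n%:R :> R by rewrite ltr0n.
exists n => //; set x := grid_pt N n; pose e := N / n%:R.
have e0 : 0 < e by rewrite divr_gt0.
have er : e < r by rewrite /e ltr_pdivrMr// mulrC -ltr_pdivrMr// truncnS_gt.
have {}hr z : 0 <= z.1 <= N -> 0 <= z.2 <= N ->
    `|u (z.1 + e, z.2) - u z + I * (u (z.1, z.2 + e) - u z)| <= d * e.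
  move=> z1 z2; apply: (hr e _ e0 z); last by split; rewrite /= in_itv.
  by rewrite /ball/= sub0r normrN gtr0_norm.
have xS k : x k + e = x k.+1 by rewrite /x /grid_pt -/e -natr1 mulrDl mul1r.
have xn : x n = N by rewrite /x /grid_pt mulrC divfK ?gt_eqF.
have x0 : x 0%N = 0 by rewrite /x /grid_pt mul0r.
have xN k : (k < n)%N -> 0 <= x k <= N.
  move=> kn; rewrite -xn /x /grid_pt -/e mulr_ge0 ?(ltW e0)//= ler_pM2r// ler_nat.
  exact: ltnW.
have -> : \sum_(0 <= j < n) (u (N, x j) - u (0, x j)) +
      I * \sum_(0 <= k < n) (u (x k, N) - u (x k, 0)) =
    \sum_(0 <= j < n) \sum_(0 <= k < n)
      (u (x k + e, x j) - u (x k, x j) + I * (u (x k, x j + e) - u (x k, x j))).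
  have -> : \sum_(0 <= j < n) \sum_(0 <= k < n)
      (u (x k + e, x j) - u (x k, x j) + I * (u (x k, x j + e) - u (x k, x j))) =
    \sum_(0 <= j < n) \sum_(0 <= k < n) (u (x k.+1, x j) - u (x k, x j)) +
    \sum_(0 <= k < n) \sum_(0 <= j < n) I * (u (x k, x j.+1) - u (x k, x j)).
    rewrite [X in _ = _ + X]exchange_big -big_split; apply: eq_bigr => j _.
    by rewrite -big_split; apply: eq_bigr => k _; rewrite !xS.
  congr (_ + _).
    apply: eq_bigr => j _.
    by rewrite (telescope_sumr (fun k => u (x k, x j)))// xn x0.
  rewrite mulr_sumr; apply: eq_bigr => k _.
  by rewrite -mulr_sumr (telescope_sumr (fun j => u (x k, x j)))// xn x0.
apply: le_trans (ler_norm_sum _ _ _) _.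
apply: (@le_trans _ _ (\sum_(0 <= j < n) \sum_(0 <= k < n) (d * e))).
  rewrite !big_mkord; apply: ler_sum => j _; apply: le_trans (ler_norm_sum _ _ _) _.
  by rewrite !big_mkord; apply: ler_sum => k _; apply: (hr (x k, x j)); apply: xN.
rewrite !sumr_const_nat subn0 -mulrnA -[_ *+ (n * n)]mulr_natr natrM /e le_eqVlt.
by apply/orP; left; apply/eqP; field; rewrite gt_eqF.
Qed.

(** A Liouville theorem: at infinity a Cauchy-Riemann function at bounded distance
    from a linear map only sees the linear map. Multiplied by
    the mesh N / n, the boundary sum of the bounded part p grows like the side N
    of the square, that of the linear part like N^2. *)
Lemma locally_cr_affine I a b (p : R * R -> quat R) (C : R) :
  locally_cr I (fun z => z.1 *: a + z.2 *: b + p z) ->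
  (forall z, `|p z| <= C) -> a + I * b = 0.
Proof.
set u := fun z => _; move=> cru pC.
pose K := 2 * C + 4 * `|I| * (2 * C).
have main N d : 0 < N -> 0 < d -> `|a + I * b| <= d + K / N.
  move=> N0 d0; have [n n0 /=] := locally_cr_grid cru N0 d0.
  set x := grid_pt N n.
  set S := (X in `|X| <= _).
  have pp z w : `|p z - p w| <= 2 * C.
    by have := ler_normB (p z) (p w); have := pC z; have := pC w; lra.
  pose E1 := \sum_(0 <= j < n) (p (N, x j) - p (0, x j)).
  pose E2 := \sum_(0 <= k < n) (p (x k, N) - p (x k, 0)).
  have E1C : `|E1| <= n%:R * (2 * C).
    apply: le_trans (ler_norm_sum _ _ _) _; rewrite big_mkord.
    apply: (@le_trans _ _ (\sum_(i < n) (2 * C))); last first.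
      by rewrite sumr_const card_ord -[leLHS]mulr_natl.
    by apply: ler_sum => i _; exact: pp.
  have E2C : `|E2| <= n%:R * (2 * C).
    apply: le_trans (ler_norm_sum _ _ _) _; rewrite big_mkord.
    apply: (@le_trans _ _ (\sum_(i < n) (2 * C))); last first.
      by rewrite sumr_const card_ord -[leLHS]mulr_natl.
    by apply: ler_sum => i _; exact: pp.
  have SE : S = (n%:R * N) *: (a + I * b) + (E1 + I * E2).
    have s1 : \sum_(0 <= j < n) (u (N, x j) - u (0, x j)) = (n%:R * N) *: a + E1.
      rewrite /E1 (eq_bigr (fun j => N *: a + (p (N, x j) - p (0, x j)))).
        by rewrite big_split/= sumr_const_nat subn0 -scaler_nat scalerA.
      by move=> j _; rewrite /u /= scale0r add0r opprD addrACA addrK.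
    have s2 : \sum_(0 <= k < n) (u (x k, N) - u (x k, 0)) = (n%:R * N) *: b + E2.
      rewrite /E2 (eq_bigr (fun k => N *: b + (p (x k, N) - p (x k, 0)))).
        by rewrite big_split/= sumr_const_nat subn0 -scaler_nat scalerA.
      move=> j _; rewrite /u /= scale0r addr0 opprD addrACA; congr (_ + _).
      by rewrite addrAC subrr add0r.
    by rewrite /S s1 s2 mulrDr -scalerAr scalerDr addrACA.
  rewrite SE => hS.
  have nN0 : 0 < n%:R * N by rewrite mulr_gt0 ?ltr0n.
  have IE2 : `|I * E2| <= n%:R * (4 * `|I| * (2 * C)).
    apply: le_trans (qmul_bound _ _) _; rewrite mulrCA ler_wpM2l ?mulr_ge0//.
  have : `|(n%:R * N) *: (a + I * b)| <= n%:R * N * d + n%:R * K.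
    rewrite -[X in `|X|](addrK (E1 + I * E2)).
    apply: le_trans (ler_normB _ _) _; rewrite lerD// /K mulrDr.
    by apply: le_trans (ler_normD _ _) _; rewrite lerD.
  rewrite normrZ gtr0_norm// -ler_pdivlMl// => /le_trans; apply.
  rewrite mulrDr mulKf ?gt_eqF// lerD2l invfM mulrACA mulVf.
    by rewrite mul1r mulrC.
  by rewrite pnatr_eq0 gtn_eqF.
have K0 : 0 <= K.
  by have := le_trans (normr_ge0 _) (pC 0) => C0; rewrite /K addr_ge0 ?mulr_ge0.
apply/eqP; rewrite -normr_eq0 eq_le normr_ge0 andbT; apply/ler_addgt0Pr => d d0.
rewrite add0r.
apply: le_trans (main ((K + 1) / (d / 2)) (d / 2) _ _) _; rewrite ?divr_gt0//; first lra.
have -> : K / ((K + 1) / (d / 2)) = d / 2 * (K / (K + 1)).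
  by field; rewrite !gt_eqF//; lra.
rewrite [leRHS]splitr lerD2l ler_piMr ?divr_ge0 ?(ltW d0)//.
by rewrite ler_pdivrMr; lra.
Qed.

End DiscreteCauchy.

(** * Lifting maps to the universal cover *)

Section Lifting.
Variable R : realType.
Implicit Types (L M : lattice R) (q x y : quat R) (g : quat R -> quat R).

(** Continuity modulo M of a choice g of representatives, which may jump by
    lattice vectors. *)
Definition continuous_mod M g := forall x (e : R), 0 < e ->
  \forall y \near x, exists2 m, lattice_set M m & `|g y - g x - m| < e.

Definition lattice_periodic L g := forall q l, lattice_set L l -> g (q + l) = g q.

Lemma closed_ball_compact (C : R) : compact [set q : quat R | `|q| <= C].
Proof.
apply: bounded_closed_compact.
  by exists C; split; [exact: num_real|move=> D CD q /= /le_trans; apply; exact: ltW].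
by apply: (@closed_comp _ _ (fun q : 'rV[R]_4 => `|q|) [set t | t <= C]);
  [move=> ? _; exact: norm_continuous|exact: closed_le].
Qed.

Lemma continuous_mod_uniform L M g (e : R) :
  lattice_periodic L g -> continuous_mod M g -> 0 < e ->
  exists2 h : R, 0 < h & forall x y, `|y - x| < h ->
    exists2 m, lattice_set M m & `|g y - g x - m| < e.
Proof.
move=> pg cg e0; have [C C0 hC] := lattice_cocompact L.
pose P (h : R) x := forall y, `|y - x| < h ->
    exists2 m, lattice_set M m & `|g y - g x - m| < e.
have loc x0 : [set q : quat R | `|q| <= C] x0 -> \forall x \near x0 & h \near 0^'+, P h x.
  move=> _; have e20 : 0 < e / 2 by rewrite divr_gt0.
  have /nbhs_ballP[r /= r0 hr] := cg x0 _ e20.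
  exists (ball x0 (r / 2), [set h : R | h < r / 2]).
    split=> /=; first by apply: nbhsx_ballx; rewrite divr_gt0.
    by apply: nbhs_right_lt; rewrite divr_gt0.
  move=> [x h] /= [xr hr2] y yx.
  have [m2 M2 m2e] : exists2 m, lattice_set M m & `|g x - g x0 - m| < e / 2.
    by apply: hr; apply: le_ball xr; rewrite ler_pdivrMr//; lra.
  have [m1 M1 m1e] : exists2 m, lattice_set M m & `|g y - g x0 - m| < e / 2.
    apply: hr; rewrite -ball_normE /ball_ /= distrC -(subrKA x).
    rewrite (splitr r) (le_lt_trans (ler_normD _ _))// ltrD//.
      exact: lt_trans yx hr2.
    by rewrite distrC; move: xr; rewrite -ball_normE.
  exists (m1 - m2); first exact: latticeB.
  have -> : g y - g x - (m1 - m2) = (g y - g x0 - m1) - (g x - g x0 - m2).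
    rewrite [RHS]addrC !opprD !opprK; by apply/rowP => i; rewrite !mxE; ring.
  by rewrite (splitr e) (le_lt_trans (ler_normB _ _))// ltrD.
have F0 : Filter ((0 : R)^'+) by exact: within_filter.
have := (compact_near_coveringP _).1 (@closed_ball_compact C) R (0^'+) P F0 loc.
rewrite /= => /nbhs_ballP[r /= r0 hr].
exists (r / 2); first by rewrite divr_gt0.
move=> x y yx; have [l Ll lC] := hC x.
have /(_ (r / 2)) := hr.
have h1 : ball 0 r (r / 2).
  by rewrite /ball/= sub0r normrN gtr0_norm ?divr_gt0// ltr_pdivrMr//; lra.
have h2 : 0 < r / 2 by rewrite divr_gt0.
move=> /(_ h1 h2 (x - l) lC (y - l)).
rewrite opprB addrA subrK => /(_ yx)[m Mm mE]; exists m => //.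
by move: mE; rewrite !(pg _ _ (latticeN Ll)).
Qed.

(** Let e be so small that M has no nonzero vector of length below 3 e, and h such
    that g moves by less than e modulo M over distances below h. Then nearby
    points have a unique small increment modulo M, and the increments around a
    small triangle add up since an error would be a vector of M shorter than
    3 e. *)
Section Lift.
Variables (M : lattice R) (g : quat R -> quat R) (e h : R).
Hypothesis h0 : 0 < h.
Hypothesis e0 : 0 < e.
Hypothesis disc : forall m, lattice_set M m -> `|m| < 3 * e -> m = 0.
Hypothesis unif : forall x y, `|y - x| < h ->
    exists2 m, lattice_set M m & `|g y - g x - m| < e.

Definition small_increment x y : quat R :=
  xget 0 [set w : quat R | `|w| < e /\ lattice_set M (g y - g x - w)].
Local Notation inc := small_increment.

Lemma small_incrementP x y : `|y - x| < h ->
  `|inc x y| < e /\ lattice_set M (g y - g x - inc x y).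
Proof.
move=> /unif[m Mm me]; rewrite /inc; case: xgetP => //= /(_ (g y - g x - m)) [].
by split=> //; rewrite [X in lattice_set _ X]subKr.
Qed.

Lemma small_increment_unique x y (w : quat R) : `|w| < e ->
  lattice_set M (g y - g x - w) -> inc x y = w.
Proof.
move=> we Mw; rewrite /inc; case: xgetP => [v _ [ve Mv]|/(_ w)]; last by case.
apply/eqP; rewrite -subr_eq0; apply/eqP/disc.
  have := latticeB Mw Mv; congr (lattice_set _ _).
  by apply/rowP => i; rewrite !mxE; ring.
apply: (@lt_trans _ _ (e + e)); last by move: e0; lra.
exact: le_lt_trans (ler_normB _ _) (ltrD ve we).
Qed.

Lemma small_incrementD x y z : `|y - x| < h -> `|z - y| < h -> `|z - x| < h ->
  inc x y + inc y z = inc x z.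
Proof.
move=> /small_incrementP[e1 m1] /small_incrementP[e2 m2] /small_incrementP[e3 m3].
apply/eqP; rewrite -subr_eq0; apply/eqP/disc.
  have := latticeB m3 (latticeD m1 m2); congr (lattice_set _ _).
  by apply/rowP => i; rewrite !mxE; ring.
apply: (@lt_le_trans _ _ (e + e + e)); last by move: e0; lra.
exact: le_lt_trans (ler_normB _ _) (ltrD (le_lt_trans (ler_normD _ _) (ltrD e1 e2)) e3).
Qed.

Lemma small_increment0 x : inc x x = 0.
Proof.
by apply: small_increment_unique; rewrite ?normr0// subrr subr0; exact: lattice0.
Qed.

(** The subdivision of the segment [0, q] is dyadic so that two levels are always
    comparable. *)
Definition radial_pt m q (k : nat) : quat R := (k%:R / 2 ^+ m : R) *: q.

Definition radial_sum m q :=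
  \sum_(0 <= k < 2 ^ m) inc (radial_pt m q k) (radial_pt m q k.+1).

Lemma radial_pt_dist m q k (d : R) : `|q| < d * 2 ^+ m ->
  `|radial_pt m q k.+1 - radial_pt m q k| < d.
Proof.
rewrite /radial_pt -scalerBl -mulrBl -[k.+1%:R]natr1 (addrC k%:R) addrK mul1r normrZ.
by rewrite gtr0_norm ?invr_gt0 ?exprn_gt0// ltr_pdivrMl ?exprn_gt0// mulrC.
Qed.

Lemma radial_ptS m q k : radial_pt m.+1 q k.*2 = radial_pt m q k.
Proof.
rewrite /radial_pt -muln2 natrM exprSr; congr (_ *: _).
by rewrite -mulf_div divff ?mulr1 ?pnatr_eq0.
Qed.

Lemma sum_pairs (F : nat -> quat R) n :
  \sum_(0 <= k < n.*2) F k = \sum_(0 <= k < n) (F k.*2 + F k.*2.+1).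
Proof.
elim: n => [|n IH]; first by rewrite !big_nil.
by rewrite doubleS !big_nat_recr//= IH addrA.
Qed.

Lemma radial_sumS m q : `|q| < h * 2 ^+ m -> radial_sum m.+1 q = radial_sum m q.
Proof.
move=> qm; rewrite /radial_sum expnS mul2n sum_pairs; apply: eq_bigr => k _.
have qm' : `|q| < h * 2 ^+ m.+1.
  by apply: lt_le_trans qm _; rewrite ler_pM2l// ler_weXn2l// ler1n.
rewrite small_incrementD ?radial_pt_dist//.
  by rewrite -doubleS !radial_ptS.
by rewrite -doubleS !radial_ptS radial_pt_dist.
Qed.

Lemma radial_sum_stable m n q : `|q| < h * 2 ^+ m -> (m <= n)%N ->
  radial_sum n q = radial_sum m q.
Proof.
move=> qm; elim: n => [|n IH]; first by rewrite leqn0 => /eqP->.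
rewrite leq_eqVlt => /orP[/eqP->//|mn]; rewrite radial_sumS ?IH//.
by apply: lt_le_trans qm _; rewrite ler_pM2l// ler_weXn2l// ler1n.
Qed.

Lemma radial_level q (d : R) : 0 < d -> exists m, `|q| < d * 2 ^+ m.
Proof.
move=> d0; exists (Num.truncn (`|q| / d)).+1.
rewrite mulrC -ltr_pdivrMr//; apply: lt_trans (truncnS_gt _) _.
by rewrite -natrX ltr_nat ltn_expl.
Qed.

Definition radial_lift q := g 0 + radial_sum (sval (cid (radial_level q h0))) q.

Lemma radial_liftE q m : `|q| < h * 2 ^+ m -> radial_lift q = g 0 + radial_sum m q.
Proof.
move=> qm; rewrite /radial_lift; case: cid => n /= qn; congr (_ + _).
by have [mn|/ltnW nm] := leqP m n; [|apply/esym]; apply: radial_sum_stable.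
Qed.

Lemma radial_pt_last m q : radial_pt m q (2 ^ m) = q.
Proof. by rewrite /radial_pt natrX divff ?scale1r// expf_neq0// pnatr_eq0. Qed.

Lemma radial_pt0 m q : radial_pt m q 0 = 0.
Proof. by rewrite /radial_pt mul0r scale0r. Qed.

Lemma radial_lift_mod q : lattice_set M (radial_lift q - g q).
Proof.
have [m qm] := radial_level q h0.
have -> : radial_lift q - g q = - \sum_(0 <= k < 2 ^ m)
    (g (radial_pt m q k.+1) - g (radial_pt m q k) -
     inc (radial_pt m q k) (radial_pt m q k.+1)).
  rewrite sumrB (telescope_sumr (fun k => g (radial_pt m q k)))// radial_pt_last radial_pt0.
  by rewrite (radial_liftE qm) -/(radial_sum m q) !opprB [RHS]addrCA addrA.
apply/latticeN/lattice_sum => k _; apply: (small_incrementP _).2.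
exact: radial_pt_dist.
Qed.

(** The lifts at q and q' are sums along two segments. Comparing them cell by cell,
    the increments from one segment to the other telescope, which leaves the
    increment from q to q'. *)
Lemma radial_lift_increment q q' : `|q' - q| < h / 2 ->
  radial_lift q' - radial_lift q = inc q q'.
Proof.
move=> qq'.
have h20 : 0 < h / 2 by rewrite divr_gt0.
have [m1 q1] := radial_level q h20; have [m2 q2] := radial_level q' h20.
pose m := maxn m1 m2.
have up k (p : quat R) (d : R) : 0 < d -> `|p| < d * 2 ^+ k ->
    (k <= m)%N -> `|p| < d * 2 ^+ m.
  move=> d0 pk km; apply: lt_le_trans pk _.
  by rewrite ler_pM2l// ler_weXn2l// ler1n.
have {}q1 := up _ _ _ h20 q1 (leq_maxl _ _).
have {}q2 := up _ _ _ h20 q2 (leq_maxr _ _).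
have hh (p : quat R) : `|p| < h / 2 * 2 ^+ m -> `|p| < h * 2 ^+ m.
  move=> /lt_le_trans; apply; rewrite ler_pM2r ?exprn_gt0//.
  by rewrite ler_pdivrMr//; move: h0; lra.
rewrite (radial_liftE (hh _ q1)) (radial_liftE (hh _ q2)) opprD addrACA subrr add0r.
rewrite /radial_sum -sumrB.
have ptd k : (k <= 2 ^ m)%N -> `|radial_pt m q' k - radial_pt m q k| < h / 2.
  move=> km; rewrite /radial_pt -scalerBr normrZ ger0_norm ?divr_ge0 ?exprn_ge0//.
  apply: le_lt_trans qq'; rewrite ler_piMl// ler_pdivrMr ?exprn_gt0// mul1r.
  by rewrite -natrX ler_nat.
rewrite big_nat (eq_bigr (fun k => inc (radial_pt m q k.+1) (radial_pt m q' k.+1) -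
    inc (radial_pt m q k) (radial_pt m q' k))).
  rewrite -big_nat (telescope_sumr (fun k => inc (radial_pt m q k) (radial_pt m q' k)))//.
  by rewrite !radial_pt_last !radial_pt0 small_increment0 subr0.
move=> k /= km.
have := ptd _ (ltnW km); have := ptd _ km.
have := radial_pt_dist k q1; have := radial_pt_dist k q2.
move: (radial_pt m q k) (radial_pt m q k.+1) (radial_pt m q' k) (radial_pt m q' k.+1).
move=> a b a' b' ab' ab bb' aa'.
have bb : `|b' - a| < h.
  by rewrite -(subrKA b) (le_lt_trans (ler_normD _ _))// (splitr h) ltrD.
have half (x : R) : x < h / 2 -> x < h by have h1 := h0; move=> xh; lra.
have E : inc a a' + inc a' b' = inc a b + inc b b'.
  by rewrite (small_incrementD (half _ aa') (half _ ab') bb)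
    (small_incrementD (half _ ab) (half _ bb') bb).
have -> : inc a' b' = inc a b + inc b b' - inc a a' by rewrite -E addrAC subrr add0r.
by apply/rowP => i; rewrite !mxE; ring.
Qed.

Lemma radial_lift_continuous : continuous_mod M g -> continuous radial_lift.
Proof.
move=> cg q; apply: (iffRL (@cvgrPdist_lt _ _ _ (nbhs q) _ _ _)) => d d0.
have de : 0 < Num.min d e by rewrite lt_min d0.
have h20 : 0 < h / 2 by rewrite divr_gt0.
have nq : \forall q' \near q, `|q' - q| < h / 2.
  by apply/nbhs_ballP; exists (h / 2) => //= x; rewrite -ball_normE /= distrC.
near=> q'; rewrite distrC.
rewrite radial_lift_increment; last by near: q'.
have [m Mm] : exists2 m, lattice_set M m & `|g q' - g q - m| < Num.min d e.
  by near: q'; exact: cg.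
rewrite lt_min => /andP[md me].
rewrite (@small_increment_unique _ _ (g q' - g q - m))//.
by rewrite [X in lattice_set _ X]subKr.
Unshelve. all: by end_near. Qed.

End Lift.

Lemma lift_exists L M g : lattice_periodic L g -> continuous_mod M g ->
  exists2 f : quat R -> quat R, continuous f & forall q, lattice_set M (f q - g q).
Proof.
move=> pg cg; have [d d0 disc] := lattice_discrete M.
have e0 : 0 < d / 3 by rewrite divr_gt0.
have [h h0 unif] := continuous_mod_uniform pg cg e0.
have disc' m : lattice_set M m -> `|m| < 3 * (d / 3) -> m = 0.
  by move=> Mm; rewrite mulrC divfK ?pnatr_eq0//; exact: disc.
exists (radial_lift M g (d / 3) h0); first exact: radial_lift_continuous.
exact: radial_lift_mod.
Qed.

End Lifting.

(** * The linear part of a lift *)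

Section LinearPart.
Variable R : realType.
Implicit Types (L M : lattice R) (q x y : quat R) (f g k : quat R -> quat R).

(** Along a segment the distance of k to its initial value is continuous, but
    omits a whole interval (0, d) because M is discrete: by the intermediate
    value theorem it is 0. *)
Lemma lattice_valued_const M k : continuous k ->
  (forall q, lattice_set M (k q)) -> forall q, k q = k 0.
Proof.
move=> ck Mk q; have [d d0 disc] := lattice_discrete M.
pose psi (t : R) := `|k (t *: q) - k 0|.
have psic : continuous psi.
  move=> t; apply: (@continuous_comp _ _ _ (fun t : R => k (t *: q) - k 0)
    (fun x : quat R => `|x|)).
    apply: continuousB; last exact: cvg_cst.
    apply: (@continuous_comp _ _ _ (fun t : R => t *: q) k); last exact: ck.
    exact: scalel_continuous.
  exact: norm_continuous.
have psi_cases t : psi t = 0 \/ d <= psi t.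
  have [h|] := ltP (psi t) d; [left|by right].
  by rewrite /psi (disc _ (latticeB (Mk _) (Mk _)) h) normr0.
have psi0 : psi 0 = 0 by rewrite /psi scale0r subrr normr0.
have [psi1|psi1] := psi_cases 1.
  by apply/eqP; rewrite -subr_eq0 -normr_eq0 -[q]scale1r; apply/eqP.
have [||c _ cE] := @IVT R psi 0 1 (d / 2) ler01.
- exact: continuous_subspaceT.
- rewrite psi0 ge_min le_max; apply/andP; split; apply/orP; [left|right]; lra.
by exfalso; have := psi_cases c; rewrite cE; move: d0; clear => d0 []; lra.
Qed.

Lemma lift_translate L M f g l : continuous f -> lattice_periodic L g ->
  (forall q, lattice_set M (f q - g q)) -> lattice_set L l ->
  forall q, f (q + l) = f q + (f l - f 0).
Proof.
move=> cf pg fg Ll q.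
have ck : continuous (fun q => f (q + l) - f q).
  move=> x; apply: continuousB; last exact: cf.
  apply: (@continuous_comp _ _ _ (fun q => q + l) f); last exact: cf.
  by apply: (@cvgD _ _ _ (nbhs x) _ (fun q => q) (fun=> l)); [exact: cvg_id|exact: cvg_cst].
have Mk x : lattice_set M (f (x + l) - f x).
  have := latticeB (fg (x + l)) (fg x); congr (lattice_set _ _).
  by rewrite (pg _ _ Ll); apply/rowP => i; rewrite !mxE; ring.
by have := lattice_valued_const ck Mk q; rewrite add0r => <-; rewrite addrCA subrr addr0.
Qed.

(** The translation part l |-> f l - f 0 is additive on L, so it extends to a
    linear map A; f - A is then L-periodic, hence bounded. *)
Lemma lift_linear_part L M f g : continuous f -> lattice_periodic L g ->
  (forall q, lattice_set M (f q - g q)) ->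
  exists A : 'M[R]_4,
    (forall l, lattice_set L l -> f l - f 0 = (l : 'rV_4) *m A) /\
    exists C : R, forall q, `|f q - (q : 'rV_4) *m A| <= C.
Proof.
move=> cf pg fg; pose rho l := f l - f 0.
have tr l : lattice_set L l -> forall q, f (q + l) = f q + rho l.
  exact: lift_translate cf pg fg.
have rhoD x y : lattice_set L y -> rho (x + y) = rho x + rho y.
  by move=> Ly; rewrite /rho tr // addrAC.
have rho0 : rho 0 = 0 by rewrite /rho subrr.
have rhoN x : lattice_set L x -> rho (- x) = - rho x.
  by move=> Lx; apply/eqP; rewrite -addr_eq0 -rhoD// addNr rho0.
have rhoMn x (n : nat) : lattice_set L x -> rho (x *+ n) = rho x *+ n.
  by move=> Lx; elim: n => [|n IH]; rewrite ?rho0// !mulrSr rhoD// IH.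
have rhoMz x (n : int) : lattice_set L x -> rho (x *~ n) = rho x *~ n.
  move=> Lx; case: n => n; first exact: rhoMn.
  by rewrite NegzE !mulrNz rhoN ?rhoMn//; exact: (latticeMz n.+1).
have [V Vu hV] := lattice_mxP L.
have LV i : lattice_set L (row i V).
  apply/hV; exists (fun j => (j == i)%:Z); rewrite rowE; congr (_ *m _).
  by apply/rowP => j; rewrite !mxE eqxx/=; case: eqP.
pose A := invmx V *m \matrix_(i < 4) (rho (row i V) : 'rV_4).
have rhoA l : lattice_set L l -> rho l = (l : 'rV_4) *m A.
  move=> /hV[n ->]; rewrite /A mulmxA mulmxK// !mulmx_sum_row.
  have [] : lattice_set L (\sum_i (\row_i0 (n i0)%:~R) 0 i *: row i V) /\
      rho (\sum_i (\row_i0 (n i0)%:~R) 0 i *: row i V) =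
      \sum_i (\row_i0 (n i0)%:~R) 0 i *: row i (\matrix_(i < 4) (rho (row i V) : 'rV_4)).
    elim/big_rec2: _ => [|i x y _ [Ly rx]]; first by split; [exact: lattice0|exact: rho0].
    have Li : lattice_set L (row i V *~ n i) by exact: latticeMz.
    rewrite mxE !scaler_int; split; first exact: latticeD.
    by rewrite rhoD// rx rhoMz// rowK.
  by [].
exists A; split; first exact: rhoA.
have [C C0 hC] := lattice_cocompact L.
have [D D0 hD] := mulmx_bound A.
have /compact_bounded[B [_ hB]] : compact (f @` [set q : quat R | `|q| <= C]).
  apply: continuous_compact; last exact: (@closed_ball_compact R C).
  exact: continuous_subspaceT.
exists (B + 1 + D * C) => q; have [l Ll lC] := hC q.
have -> : f q - (q : 'rV_4) *m A = f (q - l) - (q - l : 'rV_4) *m A.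
  have -> : f q = f (q - l) + (l : 'rV_4) *m A.
    by rewrite -(rhoA _ Ll) -(tr _ Ll) subrK.
  by rewrite [in RHS]mulmxBl [in RHS]opprB [in RHS]addrA.
apply: le_trans (ler_normB _ _) _; apply: lerD.
  by apply: hB; [rewrite ltrDl|exists (q - l)].
by apply: le_trans (hD _) _; rewrite ler_wpM2l// ltW.
Qed.

End LinearPart.

(** * Biregular maps between tori come from right multiplications *)

Section RegularMaps.
Variable R : realType.
Implicit Types (L M : lattice R) (q x y : quat R) (V W : set (quat R)).

Lemma ball_connected q (r : R) : 0 < r -> connected (ball q r).
Proof.
move=> r0; pose seg x : set (quat R) := (fun t : R => q + t *: (x - q)) @` `[0, 1]%classic.
have -> : ball q r = \bigcup_(x in ball q r) seg x.
  apply/seteqP; split=> [x qx|x [y qy [t]]].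
    exists x => //; exists 1; first by rewrite /= in_itv/= ler01 lexx.
    by rewrite scale1r addrC subrK.
  rewrite /= in_itv/= => /andP[t0 t1] <-; move: qy; rewrite -ball_normE /ball_/= => qy.
  rewrite opprD addrA subrr add0r normrN normrZ ger0_norm//.
  by apply: le_lt_trans qy; rewrite distrC ler_piMl.
apply: bigcup_connected.
  exists q => x _; exists 0; first by rewrite /= in_itv/= lexx ler01.
  by rewrite scale0r addr0.
move=> x _; apply: connected_continuous_connected; first exact: segment_connected.
apply: continuous_subspaceT => t.
apply: (@cvgD _ _ _ (nbhs t) _ (fun=> q) (fun t : R => t *: (x - q))); first exact: cvg_cst.
exact: scalel_continuous.
Qed.

Lemma small_ball_chart_dom L q : exists2 r : R, 0 < r & chart_dom L (ball q r).
Proof.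
have [d d0 disc] := lattice_discrete L.
have d20 : 0 < d / 2 by rewrite divr_gt0.
exists (d / 2) => //; split; [exact: ball_open|exact: ball_connected|].
move=> x y; rewrite !inE -ball_normE /ball_/= => qx qy /torus_projP h.
apply/eqP; rewrite -subr_eq0; apply/eqP/disc => //.
rewrite -(subrKA q) (splitr d); apply: le_lt_trans (ler_normD _ _) (ltrD _ qy).
by rewrite distrC.
Qed.

Lemma chart_proj L V q : {in V &, injective (@torus_proj R L)} -> V q ->
  chart V (torus_proj L q) = q.
Proof.
move=> inj Vq; rewrite /chart; case: xgetP => [x _ [Vx xq]|/(_ q)].
  by apply: inj; rewrite ?inE.
by case.
Qed.

Lemma chart_mem L V (t : torus L) : (torus_proj L @` V) t ->
  V (chart V t) /\ torus_proj L (chart V t) = t.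
Proof.
move=> [x Vx xt]; rewrite /chart; case: xgetP => [y _ []//|/(_ x)].
by case.
Qed.

Lemma slice_pt_continuous (I : quat R) : continuous (slice_pt I).
Proof.
suff h (z : R * R) : (fun z : R * R => z.1%:A + z.2 *: I) x @[x --> z] -->
    (z.1%:A + z.2 *: I : quat R).
  exact: h.
apply: cvgD.
  apply: (@continuous_comp _ _ _ (fun z : R * R => z.1) (fun t : R => t *: (1 : quat R))).
    exact: cvg_fst.
  exact: scalel_continuous.
apply: (@continuous_comp _ _ _ (fun z : R * R => z.2) (fun t : R => t *: I)).
  exact: cvg_snd.
exact: scalel_continuous.
Qed.

(** In charts given by small balls around a point and its image, the expression
    of F coincides with the lift f, so f inherits the regularity. *)
Lemma regular_lift_locally_cr L M (F : torus L -> torus M) (f : quat R -> quat R) I :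
  torus_regular F -> continuous f ->
  (forall q, torus_proj M (f q) = F (torus_proj L q)) -> imag_units I ->
  locally_cr I (f \o slice_pt I).
Proof.
move=> [_ regF] cf fF hI z0 d d0.
pose q0 := slice_pt I z0; pose u := f \o slice_pt I.
have [r r0 [oV cV iV]] := small_ball_chart_dom L q0.
have [s s0 [oW cW iW]] := small_ball_chart_dom M (f q0).
set V := ball q0 r in oV cV iV; set W := ball (f q0) s in oW cW iW.
pose Om := V `&` [set q | (torus_proj M @` W) (F (torus_proj L q))].
pose h := (fun q => chart W (F (torus_proj L q))) \o slice_pt I.
have near_q0 : \forall q \near q0, V q /\ W (f q).
  near=> q; split; first by near: q; exact: nbhsx_ballx.
  by near: q; apply: cf; exact: nbhsx_ballx.
have {}near_q0 : \forall z \near z0, V (slice_pt I z) /\ W (f (slice_pt I z)).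
  exact: (@slice_pt_continuous I z0 _ near_q0).
have hu : \forall z \near z0, u z = h z.
  apply: filterS near_q0 => z [_ Wz].
  by rewrite /h /u /= -fF chart_proj.
have reg : \forall z \near z0, Om (slice_pt I z).
  by apply: filterS near_q0 => z [Vz Wz]; split=> //=; exists (f (slice_pt I z)).
have SR := regF V W (And3 oV cV iV) (And3 oW cW iW) I hI.
have [_ ch1 ch2 CR] := SR z0 (nbhs_singleton reg).
have der v : v = (1, 0) \/ v = (0, 1) -> \forall z \near z0, derivable u z v.
  move=> hv; near=> z.
  have : derivable h z v.
    have Oz : Om (slice_pt I z) by near: z.
    case: (SR z Oz) => -[d1 d2] _ _ _.
    by case: hv => ->; [exact: d1|exact: d2].
  apply: near_eq_derivable; near: z; apply: nbhs_interior.
  by apply: filterS hu => z ->.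
have Deq v : \forall z \near z0, 'D_v u z = 'D_v h z.
  near=> z; apply: near_eq_derive; near: z; apply: nbhs_interior; exact: hu.
have cD v : {for z0, continuous ('D_v h)} -> {for z0, continuous ('D_v u)}.
  move=> ch; rewrite /prop_for /continuous_at.
  rewrite (nbhs_singleton (Deq v)); apply: cvg_trans ch.
  by apply: near_eq_cvg; apply: filterS (Deq v) => z ->.
have d40 : 0 < d / (1 + 4 * `|I|) by rewrite divr_gt0// ltr_pwDl// mulr_ge0.
have e1 := increment_estimate (der _ (or_introl erefl)) (cD _ ch1) d40.
have e2 := increment_estimate (der _ (or_intror erefl)) (cD _ ch2) d40.
have e3 : \forall z \near z0 & e \near 0^'+, 0 < (e : R).
  exists (setT, [set e : R | 0 < e]); last by move=> [z e] [].
  by split; [exact: filterT|exact: nbhs_right_gt].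
apply: filterS3 e1 e2 e3 => -[z e] /= E1 E2 e0.
rewrite (nbhs_singleton (Deq _)) in E1; rewrite (nbhs_singleton (Deq _)) in E2.
set X := 'D_(1, 0) h z0 in E1; set Y := 'D_(0, 1) h z0 in E2.
have {}CR : X + I * Y = 0.
  move: CR => /(congr1 (fun q => 2 *: q)).
  by rewrite scalerA divff ?pnatr_eq0// scale1r scaler0.
have z1 : z + e *: (1, 0) = (z.1 + e, z.2).
  case: z {E1 E2} => a b.
  by congr (_, _); rewrite /= ?scaler0 ?addr0// -[e%:A]/(e * 1) mulr1.
have z2 : z + e *: (0, 1) = (z.1, z.2 + e).
  case: z {E1 E2 z1} => a b.
  by congr (_, _); rewrite /= ?scaler0 ?addr0// -[e%:A]/(e * 1) mulr1.
rewrite z1 in E1; rewrite z2 in E2.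
have -> : (f \o slice_pt I) (z.1 + e, z.2) - (f \o slice_pt I) z +
     I * ((f \o slice_pt I) (z.1, z.2 + e) - (f \o slice_pt I) z) =
   (u (z.1 + e, z.2) - u z - e *: X) + I * (u (z.1, z.2 + e) - u z - e *: Y).
  rewrite [in RHS]mulrBr addrACA -opprD -scalerAr -scalerDr CR scaler0 oppr0 addr0.
  by [].
apply: le_trans (ler_normD _ _) _.
apply: (@le_trans _ _ (d / (1 + 4 * `|I|) * e + 4 * `|I| * (d / (1 + 4 * `|I|) * e))).
  apply: (lerD E1); apply: le_trans (qmul_bound _ _) _.
  by apply: ler_wpM2l E2; rewrite mulr_ge0.
rewrite le_eqVlt; apply/orP; left; apply/eqP; field.
by rewrite gt_eqF// ltr_pwDl// mulr_ge0.
Unshelve. all: by end_near. Qed.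

Definition torus_rep L M (F : torus L -> torus M) q : quat R :=
  repr (F (torus_proj L q)).

Lemma torus_repE L M (F : torus L -> torus M) q :
  torus_proj M (torus_rep F q) = F (torus_proj L q).
Proof. exact: reprK. Qed.

Lemma torus_rep_periodic L M (F : torus L -> torus M) :
  lattice_periodic L (torus_rep F).
Proof.
move=> q l Ll; rewrite /torus_rep; congr (repr (F _)); apply/torus_projP.
by rewrite addrC addKr.
Qed.

Lemma torus_rep_continuous_mod L M (F : torus L -> torus M) :
  continuous F -> continuous_mod M (torus_rep F).
Proof.
move=> cF x e e0; pose g := torus_rep F.
pose N : set (quat R) := \bigcup_(m in lattice_set M) ball (g x + m) e.
pose U : set (torus M) := torus_proj M @` N.
have NU : torus_proj M @^-1` U = N.
  apply/seteqP; split=> [y [y' [m Mm ym]] /torus_projP yy'|y Ny]; last by exists y.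
  exists (m - (y' - y)); first exact: latticeB.
  move: ym; rewrite -ball_normE /ball_/=; congr (`|_| < _).
  by apply/rowP => i; rewrite !mxE; ring.
have oU : open U.
  rewrite /open /= /quotient_open -[X in open X]/(torus_proj M @^-1` U) NU.
  by apply: bigcup_open => m _; exact: ball_open.
have Ux : U (F (torus_proj L x)).
  exists (g x); last exact: torus_repE.
  by exists 0; [exact: lattice0|rewrite addr0; exact: ballxx].
have cFp : continuous (F \o torus_proj L).
  by move=> y; apply: continuous_comp; [exact: pi_continuous|exact: cF].
have nU : \forall y \near x, U (F (torus_proj L y)).
  exact: cFp x U (open_nbhs_nbhs (conj oU Ux)).
apply: filterS nU => y Uy.
have : N (g y) by rewrite -NU /= torus_repE.
move=> [m Mm]; rewrite -ball_normE /ball_/= distrC opprD addrA => h.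
by exists m.
Qed.

Lemma torus_map_lift L M (F : torus L -> torus M) : continuous F ->
  exists2 f : quat R -> quat R, continuous f &
    forall q, torus_proj M (f q) = F (torus_proj L q).
Proof.
move=> cF.
have [f cf fg] := lift_exists (torus_rep_periodic F) (torus_rep_continuous_mod cF).
by exists f => // q; have /torus_projP -> := fg q; exact: torus_repE.
Qed.

Lemma lift_of_translate L M (F : torus L -> torus M) (f : quat R -> quat R) l :
  continuous f -> (forall q, torus_proj M (f q) = F (torus_proj L q)) ->
  lattice_set L l -> forall q, f (q + l) = f q + (f l - f 0).
Proof.
move=> cf fF; apply: (@lift_translate R L M f _ l cf (@torus_rep_periodic L M F)) => q.
by apply/torus_projP; rewrite fF torus_repE.
Qed.

(** The linear part A of the lift satisfies A I = I (A 1) for every imaginary unit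
    I; for I = i, j, k, linearity then gives A l = l (A 1) for all l. *)
Lemma regular_lift_mul L M (F : torus L -> torus M) (f : quat R -> quat R) :
  torus_regular F -> continuous f ->
  (forall q, torus_proj M (f q) = F (torus_proj L q)) ->
  exists a, forall l, lattice_set L l -> f l - f 0 = l * a.
Proof.
move=> rF cf fF.
have fg q : lattice_set M (f q - torus_rep F q).
  by apply/torus_projP; rewrite fF torus_repE.
have [A [fA [C hC]]] := lift_linear_part cf (@torus_rep_periodic L M F) fg.
pose mulA q : quat R := (q : 'rV_4) *m A.
have mulAD x y : mulA (x + y) = mulA x + mulA y by rewrite /mulA mulmxDl.
have mulAZ (t : R) x : mulA (t *: x) = t *: mulA x by rewrite /mulA -scalemxAl.
have unitA I : imag_units I -> mulA I = I * mulA 1.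
  move=> hI; have cr := regular_lift_locally_cr rF cf fF hI.
  have : mulA 1 + I * mulA I = 0.
    pose p z := f (slice_pt I z) - mulA (slice_pt I z).
    apply: (@locally_cr_affine R I (mulA 1) (mulA I) p C); last by move=> z; exact: hC.
    congr (locally_cr I _): cr; apply/funext => z /=.
    have E : mulA (slice_pt I z) = z.1 *: mulA 1 + z.2 *: mulA I.
      by rewrite /slice_pt mulAD !mulAZ.
    by rewrite /p -E [RHS]addrCA subrr addr0.
  move=> /(congr1 (fun q => I * q)).
  rewrite mulr0 mulrDr mulrA imag_unit_sqr// mulN1r => /eqP.
  by rewrite subr_eq0 => /eqP.
exists (mulA 1) => l Ll; rewrite fA// -/(mulA l).
have u1 : imag_units (mkquat 0 1 0 0 : quat R).
  by apply/imag_unitP; rewrite !mkquatE; split; ring.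
have u2 : imag_units (mkquat 0 0 1 0 : quat R).
  by apply/imag_unitP; rewrite !mkquatE; split; ring.
have u3 : imag_units (mkquat 0 0 0 1 : quat R).
  by apply/imag_unitP; rewrite !mkquatE; split; ring.
have lE : l = re l *: 1 + im_i l *: mkquat 0 1 0 0 + im_j l *: mkquat 0 0 1 0
    + im_k l *: mkquat 0 0 0 1.
  by apply: quatP; rewrite !quatE; ring.
move: (mkquat 0 1 0 0) (mkquat 0 0 1 0) (mkquat 0 0 0 1) u1 u2 u3 lE.
move: (re l) (im_i l) (im_j l) (im_k l) => t x y z qi qj qk u1 u2 u3 ->.
move: mulA mulAD mulAZ unitA {fA hC} => mulA mulAD mulAZ unitA.
by rewrite !mulAD !mulAZ (unitA _ u1) (unitA _ u2) (unitA _ u3) !mulrDl -!scalerAl mul1r.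
Qed.

(** The lifts f and f' of F and of its inverse act on the lattices by l |-> l a and
    m |-> m b. The composite f o f' lifts the identity, so it is a translation,
    which gives m = m b a and thus the surjectivity of l |-> l a onto M. *)
Lemma torus_equiv_lattice L M : torus_equiv L M ->
  exists2 a, a != 0 & forall q, lattice_set M q <-> exists2 l, lattice_set L l & q = l * a.
Proof.
move=> [F [G [FG GF rF rG]]].
have [f cf fF] := torus_map_lift rF.1; have [f' cf' fG] := torus_map_lift rG.1.
have [a fa] := regular_lift_mul rF cf fF; have [b fb] := regular_lift_mul rG cf' fG.
have La l : lattice_set L l -> lattice_set M (l * a).
  move=> Ll; rewrite -fa//; apply/torus_projP; rewrite !fF; congr F.
  by apply/torus_projP; rewrite subr0.
have Mb m : lattice_set M m -> lattice_set L (m * b).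
  move=> Mm; rewrite -fb//; apply/torus_projP; rewrite !fG; congr G.
  by apply/torus_projP; rewrite subr0.
have ff' q : f (f' q) = f (f' 0) + q.
  suff /(_ q) : forall q, f (f' q) - q = f (f' 0) - 0.
    by rewrite (subr0 (f (f' 0))) => /eqP; rewrite subr_eq => /eqP.
  apply: (@lattice_valued_const _ M) => [{}q|{}q].
    apply: (@cvgB _ _ _ (nbhs q) _ (f \o f') id); last exact: cvg_id.
    exact: (@continuous_comp _ _ _ f' f q (cf' q) (cf _)).
  by apply/torus_projP; rewrite fF fG GF.
have ba m : lattice_set M m -> m = m * b * a.
  move=> Mm; have := ff' m.
  have -> : f' m = f' 0 + m * b by rewrite -fb// addrC subrK.
  rewrite (lift_of_translate cf fF (Mb _ Mm)) (fa _ (Mb _ Mm)).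
  by move=> /addrI ->.
exists a; last first.
  move=> q; split=> [Mq|[l Ll ->]]; last exact: La.
  by exists (q * b); [exact: Mb|exact: ba].
have [m [Mm m0 _]] := lattice_min_vector M.
by apply: contra_neq m0 => a0; rewrite (ba _ Mm) a0 mulr0.
Qed.

End RegularMaps.

(** * Right multiplications are biregular *)

Section RightMultiplication.
Variable R : realType.
Implicit Types (L M : lattice R) (q x y a : quat R) (V W : set (quat R)).

Lemma qmulr_continuous a : continuous (fun q => q * a).
Proof.
move=> q; apply: (iffRL (@cvgrPdist_lt _ _ _ (nbhs q) _ _ _)) => e e0.
have c0 : 0 < 4 * `|a| + 1 by rewrite ltr_wpDl// mulr_ge0.
have nq : \forall y \near q, `|q - y| < e / (4 * `|a| + 1).
  apply/nbhs_ballP; exists (e / (4 * `|a| + 1)); first by rewrite /= divr_gt0.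
  by move=> y; rewrite -ball_normE.
apply: filterS nq => y; rewrite ltr_pdivlMr// => qy.
rewrite -mulrBl; apply: le_lt_trans (qmul_bound _ _) _; apply: le_lt_trans qy.
by rewrite mulrDr mulr1 mulrA [_ * 4]mulrC lerDl.
Qed.

Lemma affine_derive (V : normedModType R) (h : V -> quat R) (v z : V) (c : quat R) :
  (forall (t : R) (x : V), h (t *: v + x) = t *: c + h x) ->
  derivable h z v /\ 'D_v h z = c.
Proof.
move=> hh; have H : (fun t : R => t^-1 *: ((h \o shift z) (t *: v) - h z)) @ 0^' --> c.
  apply: cvg_near_cst; near=> t.
  rewrite /= hh addrK scalerA mulVf ?scale1r//.
  by near: t; exact: nbhs_dnbhs_neq.
by split; [apply/cvg_ex; exists c|apply: cvg_lim].
Unshelve. all: by end_near. Qed.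

(** In charts the map is q |-> q a + m with m constant near each point. Its
    restriction to a slice is affine with derivatives a and I a, and
    a + I (I a) = 0. *)
Lemma right_mul_regular L M a : (forall l, lattice_set L l -> lattice_set M (l * a)) ->
  exists2 F : torus L -> torus M, torus_regular F &
    forall q, F (torus_proj L q) = torus_proj M (q * a).
Proof.
move=> La; pose F (t : torus L) := torus_proj M (repr t * a).
have Fp q : F (torus_proj L q) = torus_proj M (q * a).
  apply/torus_projP; rewrite -mulrBl; apply/La/torus_projP; exact: reprK.
exists F => //; split.
  apply/quotient_continuous.
  have -> : F \o \pi_(torus L)%qT = torus_proj M \o (fun q => q * a).
    by apply/funext => q; exact: Fp.
  by move=> q; apply: continuous_comp; [exact: qmulr_continuous|exact: pi_continuous].
move=> V W [oV _ _] [oW _ iW] I hI f_I z [Vz Wz].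
pose q0 := slice_pt I z.
have [Ww wF] := chart_mem Wz; set w := chart W _ in Ww wF.
rewrite Fp in wF; have /torus_projP Mm := wF.
set m := w - _ in Mm.
pose h u := slice_pt I u * a + m.
have f_near : \forall u \near z, f_I u = h u.
  have ch : continuous h.
    move=> u; apply: (@cvgD _ _ _ (nbhs u) _ (fun u => slice_pt I u * a) (fun=> m)).
      apply: (@continuous_comp _ _ _ (slice_pt I) (fun q => q * a)).
        exact: slice_pt_continuous.
      exact: qmulr_continuous.
    exact: cvg_cst.
  have hz : h z = w by rewrite /h /m addrC subrK.
  have nW : \forall u \near z, W (h u).
    by apply: ch; rewrite hz; exact: open_nbhs_nbhs.
  apply: filterS nW => u Wx; rewrite /f_I /= Fp -[RHS](chart_proj iW Wx).
  congr (chart W _); apply/torus_projP; rewrite /h opprD addrA subrr add0r.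
  exact: latticeN.
have hv v : forall (t : R) (u : R * R), h (t *: v + u) = t *: (slice_pt I v * a) + h u.
  move=> t u; have E : slice_pt I (t *: v + u) = t *: slice_pt I v + slice_pt I u.
    by rewrite /slice_pt /= !scalerDl scalerDr !scalerA addrACA.
  by rewrite /h E mulrDl -scalerAl [RHS]addrA.
have der v u : derivable h u v /\ 'D_v h u = slice_pt I v * a.
  exact: affine_derive (hv v).
have f_der v : \forall u \near z, derivable f_I u v /\ 'D_v f_I u = slice_pt I v * a.
  near=> u.
  have fh : \forall u' \near u, f_I u' = h u'.
    by near: u; apply: nbhs_interior; exact: f_near.
  have [d1 d2] := der v u; split.
    by apply: near_eq_derivable d1; apply: filterS fh => u' ->.
  by rewrite -d2; apply: near_eq_derive.
have f_cont v : {for z, continuous ('D_v f_I)}.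
  rewrite /prop_for /continuous_at (nbhs_singleton (f_der v)).2.
  by apply: cvg_near_cst; apply: filterS (f_der v) => u [].
have [d1 e1] := nbhs_singleton (f_der (1, 0)).
have [d2 e2] := nbhs_singleton (f_der (0, 1)).
split; [by split; [exact: d1|exact: d2]|exact: f_cont|exact: f_cont|].
rewrite e1 e2 /slice_pt /= !scale0r !scale1r addr0 add0r mul1r.
by rewrite mulrA imag_unit_sqr// mulN1r subrr scaler0.
Unshelve. all: by end_near. Qed.

Lemma lattice_torus_equiv L M a : a != 0 ->
  (forall q, lattice_set M q <-> exists2 l, lattice_set L l & q = l * a) ->
  torus_equiv L M.
Proof.
move=> a0 hM.
have [F rF FE] := @right_mul_regular L M a (fun l Ll => (hM _).2 (ex_intro2 _ _ l Ll erefl)).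
have Mi m : lattice_set M m -> lattice_set L (m * qinv a).
  by move=> /hM[l Ll ->]; rewrite -mulrA qmul_inv// mulr1.
have [G rG GE] := right_mul_regular Mi.
exists F, G; split=> // t.
  by have [q <-] := torus_proj_surj t; rewrite FE GE -mulrA qmul_inv// mulr1.
by have [q <-] := torus_proj_surj t; rewrite GE FE -mulrA qinv_mul// mulr1.
Qed.

End RightMultiplication.

(** * Lipschitz and Hurwitz quaternions *)

Section LipschitzHurwitz.
Variable R : realType.
Implicit Types (p q x y a b I J : quat R).

Definition lipschitz_quat x : Prop :=
  [/\ re x \is a Num.int, im_i x \is a Num.int, im_j x \is a Num.int &
      im_k x \is a Num.int].

(** The coordinates are all integers or all half-odd: their differences are
    integers, and so is the double of one of them. This linear description makes
    stability under multiplication by omega a direct computation. *)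
Definition hurwitz_quat x : Prop :=
  [/\ 2 * re x \is a Num.int, im_i x - re x \is a Num.int,
      im_j x - re x \is a Num.int & im_k x - re x \is a Num.int].

Lemma lipschitzM x y : lipschitz_quat x -> lipschitz_quat y -> lipschitz_quat (x * y).
Proof.
move=> [x0 x1 x2 x3] [y0 y1 y2 y3]; rewrite /lipschitz_quat !quatM.
by split; do ![by [] | apply: rpredM | apply: rpredB | apply: rpredD].
Qed.

Lemma lipschitz_conj x : lipschitz_quat x -> lipschitz_quat (qconj x).
Proof. by move=> [x0 x1 x2 x3]; rewrite /lipschitz_quat !qconjE; split; rewrite ?rpredN. Qed.

Definition omega : quat R := mkquat 2^-1 2^-1 2^-1 2^-1.

Lemma hurwitz_mul_omega x : hurwitz_quat x -> hurwitz_quat (x * omega).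
Proof.
move=> [/intrP[t x0] /intrP[a x1] /intrP[b x2] /intrP[c x3]].
have {}x1 : im_i x = re x + a%:~R by rewrite -x1 addrC subrK.
have {}x2 : im_j x = re x + b%:~R by rewrite -x2 addrC subrK.
have {}x3 : im_k x = re x + c%:~R by rewrite -x3 addrC subrK.
rewrite /hurwitz_quat !quatM !mkquatE x1 x2 x3; split; apply/intrP.
- exists (- t - a - b - c); rewrite !intrB intrN -x0; by field.
- exists (t + a + b); rewrite !intrD -x0; by field.
- exists (t + b + c); rewrite !intrD -x0; by field.
- exists (t + a + c); rewrite !intrD -x0; by field.
Qed.

Lemma hurwitz_mul_omegaV x : hurwitz_quat x -> hurwitz_quat (x * qconj omega).
Proof.
move=> [/intrP[t x0] /intrP[a x1] /intrP[b x2] /intrP[c x3]].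
have {}x1 : im_i x = re x + a%:~R by rewrite -x1 addrC subrK.
have {}x2 : im_j x = re x + b%:~R by rewrite -x2 addrC subrK.
have {}x3 : im_k x = re x + c%:~R by rewrite -x3 addrC subrK.
rewrite /hurwitz_quat !quatM !qconjE !mkquatE x1 x2 x3; split; apply/intrP.
- exists (t + t + a + b + c); rewrite !intrD -x0; by field.
- exists (- t - b); rewrite !(intrB, intrN) -x0; by field.
- exists (- t - c); rewrite !(intrB, intrN) -x0; by field.
- exists (- t - a); rewrite !(intrB, intrN) -x0; by field.
Qed.

Lemma omega_sqr : omega * omega = omega - 1.
Proof. by apply: quatP; rewrite !quatE; field. Qed.

Lemma twoD4_frame I J : twoD4 I J =
  in_frame I J @` [set x | lipschitz_quat x /\ normsq x = 1].
Proof.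
have lipE (a b c d : int) :
    lipschitz_quat (mkquat a%:~R b%:~R c%:~R d%:~R).
  by rewrite /lipschitz_quat !mkquatE !intr_int.
have normE (a b c d : int) : normsq (mkquat a%:~R b%:~R c%:~R d%:~R : quat R) =
    (a ^+ 2 + b ^+ 2 + c ^+ 2 + d ^+ 2)%:~R.
  by rewrite normsqE !mkquatE !intrD !rmorphXn.
have frE (a b c d : int) : in_frame I J (mkquat a%:~R b%:~R c%:~R d%:~R) =
    1 *~ a + I *~ b + J *~ c + (I * J) *~ d.
  by rewrite /in_frame !mkquatE !scaler_int.
apply/seteqP.
split=> [q|q [x [[/intrP[a xa] /intrP[b xb] /intrP[c xc] /intrP[d xd]] xN] <-]].
  have ex (a b c d : int) : a ^+ 2 + b ^+ 2 + c ^+ 2 + d ^+ 2 = 1 ->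
      q = 1 *~ a + I *~ b + J *~ c + (I * J) *~ d ->
      (in_frame I J @` [set x | lipschitz_quat x /\ normsq x = 1]) q.
    move=> h ->; exists (mkquat a%:~R b%:~R c%:~R d%:~R); last exact: frE.
    by split; [exact: lipE|rewrite normE h].
  rewrite /twoD4 /=.
  case=> [[[[[[[h|h]|h]|h]|h]|h]|h]|h].
  - by apply: (ex 1 0 0 0) => //; rewrite h !mulr0z !addr0.
  - by apply: (ex (-1) 0 0 0) => //; rewrite h !mulr0z !addr0.
  - by apply: (ex 0 1 0 0) => //; rewrite h !mulr0z !addr0 add0r.
  - by apply: (ex 0 (-1) 0 0) => //; rewrite h !mulr0z !addr0 add0r.
  - by apply: (ex 0 0 1 0) => //; rewrite h !mulr0z !addr0 !add0r.
  - by apply: (ex 0 0 (-1) 0) => //; rewrite h !mulr0z !addr0 !add0r.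
  - by apply: (ex 0 0 0 1) => //; rewrite h !mulr0z !add0r.
  - by apply: (ex 0 0 0 (-1)) => //; rewrite h !mulr0z !add0r.
have xE : x = mkquat a%:~R b%:~R c%:~R d%:~R.
  by apply: quatP; rewrite !mkquatE.
have abcd : a ^+ 2 + b ^+ 2 + c ^+ 2 + d ^+ 2 = 1.
  by move/eqP: xN; rewrite xE normE -[1]/(1%:~R) eqr_int => /eqP.
rewrite xE frE /twoD4 /=.
have sm (n : int) : n ^+ 2 <= 1 -> n = 0 \/ n = 1 \/ n = -1.
  by rewrite expr2 => h; nia.
have [a2 b2 c2 d2] : [/\ a ^+ 2 <= 1, b ^+ 2 <= 1, c ^+ 2 <= 1 & d ^+ 2 <= 1].
  have := sqr_ge0 a; have := sqr_ge0 b; have := sqr_ge0 c; have := sqr_ge0 d.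
  by move: abcd; split; lia.
move/eqP: abcd {xE xN xa xb xc xd a2 b2 c2 d2 sm}
  (sm a a2) (sm b b2) (sm c c2) (sm d d2) => abcd.
case=> [a0|[a0|a0]] [b0|[b0|b0]] [c0|[c0|c0]] [d0|[d0|d0]];
  move: abcd; rewrite a0 b0 c0 d0 // => _; rewrite !mulr0z ?addr0 ?add0r;
  by do ![by left | by right | left].
Qed.

Lemma twoD4_sqr I J q : imag_units I -> imag_units J -> qdot I J = 0 ->
  twoD4 I J q -> q * q = 1 \/ q * q = -1.
Proof.
move=> hI hJ hIJ.
have ii := imag_unit_sqr hI; have jj := imag_unit_sqr hJ.
have kk : I * J * (I * J) = -1.
  by rewrite mulrA -[I * J * I]mulrA (imag_unit_anticomm hI hJ hIJ) mulrN mulrA ii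
    mulN1r opprK jj.
rewrite /twoD4 /=.
by case=> [[[[[[[->|->]|->]|->]|->]|->]|->]|->];
  rewrite ?mulrNN ?mulr1 ?ii ?jj ?kk; auto.
Qed.

Lemma basis1_frame I J (c : 'I_4 -> R) : imag_units I -> imag_units J -> qdot I J = 0 ->
  \sum_(i < 4) c i *: tnth (basis1 (I, J, J * I)) i =
  in_frame I J (mkquat (c (inord 0)) (c (inord 1)) (c (inord 2)) (- c (inord 3))).
Proof.
move=> hI hJ hIJ; rewrite sum_coords /in_frame !mkquatE.
rewrite !(tnth_nth 0) /= !inordK//= (imag_unit_anticomm hI hJ hIJ).
by rewrite scaleNr scalerN.
Qed.

Lemma basis1_frame_free I J : imag_units I -> imag_units J -> qdot I J = 0 ->
  free (basis1 (I, J, J * I)).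
Proof.
move=> hI hJ hIJ; apply/freeP => c.
under eq_bigr do rewrite -tnth_nth.
rewrite basis1_frame// => /(congr1 (@normsq R)).
rewrite in_frame_normsq// [RHS](_ : _ = 0); last by apply/eqP; rewrite normsq_eq0.
move=> /eqP; rewrite normsq_eq0 => /eqP h i.
have := congr1 (@re R) h; have := congr1 (@im_i R) h.
have := congr1 (@im_j R) h; have := congr1 (@im_k R) h.
rewrite !mkquatE !re0 => /eqP; rewrite oppr_eq0 => /eqP h3 h2 h1 h0.
rewrite -[i]inord_val; case: i => -[|[|[|[|//]]]] ? /=; by [].
Qed.

(** The basis ends with J I = - I J; the sign of the last coordinate does not
    affect integrality. *)
Lemma zspan_basis1_frame I J : imag_units I -> imag_units J -> qdot I J = 0 ->
  zspan (basis1 (I, J, J * I)) = in_frame I J @` lipschitz_quat.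
Proof.
move=> hI hJ hIJ; apply/seteqP.
split=> [q [n ->]|q [x [/intrP[a xa] /intrP[b xb] /intrP[c xc] /intrP[d xd]] <-]].
  under eq_bigr do rewrite -scaler_int.
  rewrite basis1_frame//; eexists; last by [].
  by rewrite /lipschitz_quat !mkquatE rpredN !intr_int.
exists (fun i => nth 0 [:: a; b; c; - d] i).
under eq_bigr do rewrite -scaler_int.
rewrite basis1_frame// !inordK//= intrN opprK; congr (in_frame _ _ _).
by apply: quatP; rewrite !mkquatE.
Qed.

Lemma gram_basis1_frame I J : imag_units I -> imag_units J -> qdot I J = 0 ->
  gram (basis1 (I, J, J * I)) = 1%:M.
Proof.
move=> hI hJ hIJ.
have IN := imag_unit_normsq hI; have JN := imag_unit_normsq hJ.
have /imag_unitP[i0 _] := hI; have /imag_unitP[j0 _] := hJ.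
have d1 : qdot 1 (J * I) = 0.
  move: hIJ; rewrite qdot1 qdotE !quatE i0 j0; lra.
have d2 : qdot I (J * I) = 0.
  by rewrite -{1}[I]mul1r qdotM2r qdot1 j0 mulr0.
have d3 : qdot J (J * I) = 0.
  by rewrite -{1}[J]mulr1 qdotM2l qdot1 i0 mulr0.
have d4 : qdot (J * I) (J * I) = 1 by rewrite qdotM2l -/(normsq I) IN JN mulr1.
apply/matrixP => k l; rewrite !mxE !(tnth_nth 0).
case: k => -[|[|[|[|//]]]] ? ; case: l => -[|[|[|[|//]]]] ? /=;
  by rewrite ?(d1, d2, d3, d4, qdot1, i0, j0, re1, hIJ) // qdotC
    ?(d1, d2, d3, d4, qdot1, i0, j0, re1, hIJ).
Qed.

(** An orthonormal basis has Gram matrix 1, which is reduced because a nonzero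
    integral vector has squared length at least 1. *)
Lemma frame_moduli I J : imag_units I -> imag_units J -> qdot I J = 0 ->
  moduli (I, J, J * I).
Proof.
move=> hI hJ hIJ; split; [exact: basis1_frame_free|by []|].
rewrite gram_basis1_frame//; split=> [i j ij|k n gn].
  by rewrite mxE ler0n.
rewrite /=; set nR : 'rV[R]_4 := map_mx _ _.
rewrite mulmx1 !mxE eqxx.
have sq j : nR 0 j * nR^T j 0 = ((n 0 j) ^+ 2)%:~R.
  by rewrite !mxE -expr2 rmorphXn.
rewrite (eq_bigr _ (fun j _ => sq j)).
have [j nj] : exists j, n 0 j != 0.
  apply/existsP; rewrite -negb_forall; apply/negP => /forallP n0.
  suff g0 : \big[gcdz/0]_(i < 4 | (k <= i)%N) n 0 i = 0 by rewrite g0 in gn.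
  by elim/big_rec: _ => // i x _ ->; rewrite (eqP (n0 i)) gcd0z.
rewrite (bigD1 j)//= ler_wpDr//.
  by rewrite sumr_ge0 // => i _; rewrite ler0z sqr_ge0.
rewrite -[1]/(1%:~R) ler_int; nia.
Qed.

End LipschitzHurwitz.

Arguments lipschitz_quat {R} x.
Arguments hurwitz_quat {R} x.

(** * The automorphism group and the stable lattices of norm one *)

Section AutomorphismGroup.
Variable R : realType.
Implicit Types (L M : lattice R) (p q x y a b I J : quat R).

Definition lattice_units L : set (quat R) :=
  [set a | normsq a = 1 /\ forall q, lattice_set L (q * a) <-> lattice_set L q].

Lemma normsq1_neq0 a : normsq a = 1 -> a != 0.
Proof. by move=> aN; rewrite -normsq_eq0 aN oner_eq0. Qed.

Lemma lattice_units1 L : lattice_units L 1.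
Proof. by split; [exact: normsq1|move=> q; rewrite mulr1]. Qed.

Lemma lattice_unitsM L a b :
  lattice_units L a -> lattice_units L b -> lattice_units L (a * b).
Proof.
move=> [aN aL] [bN bL]; split; first by rewrite normsqM aN bN mulr1.
by move=> q; rewrite mulrA bL aL.
Qed.

Definition right_mul_map L a (t : torus L) : torus L := torus_proj L (repr t * a).

Lemma right_mul_mapE L a q : lattice_units L a ->
  right_mul_map a (torus_proj L q) = torus_proj L (q * a).
Proof.
move=> [_ aL]; apply/torus_projP; rewrite -mulrBl aL; apply/torus_projP.
exact: reprK.
Qed.

Lemma torus_autP L (F : torus L -> torus L) :
  torus_aut L F <-> exists2 a, lattice_units L a & F = @right_mul_map L a.
Proof.
have unitsP a : sphere3 a /\ [set q * a | q in lattice_set L] = lattice_set L <->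
    lattice_units L a.
  rewrite sphere3E; split=> -[aN aL]; split=> //.
    move=> q; rewrite -{1}aL; split=> [[q' Lq' /eqP]|Lq]; last by exists q.
    rewrite -subr_eq0 -mulrBl qmul_eq0 (negPf (normsq1_neq0 aN)) orbF subr_eq0.
    by move=> /eqP <-.
  apply/seteqP; split=> [q [l Ll <-]|q Lq]; first by apply/aL.
  have a0 := normsq1_neq0 aN.
  by exists (q * qinv a); [apply/aL|]; rewrite -mulrA qinv_mul// mulr1.
split=> [[a [aS aL Fa]]|[a aU ->]].
  have aU : lattice_units L a by apply/unitsP.
  exists a => //; apply/funext => t; have [q <-] := torus_proj_surj t.
  by rewrite Fa right_mul_mapE.
have [aS aL] := (unitsP a).2 aU.
by exists a; split=> // q; exact: right_mul_mapE.
Qed.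

(** If a and b act in the same way, then q |-> q (a - b) is continuous with values
    in L, hence constant. *)
Lemma right_mul_map_inj L a b : lattice_units L a -> lattice_units L b ->
  @right_mul_map L a = @right_mul_map L b -> a = b.
Proof.
move=> aU bU ab; apply/eqP; rewrite -subr_eq0; apply/eqP.
have := @lattice_valued_const R L (fun q => q * (a - b)) (@qmulr_continuous R _) _ 1.
rewrite mul1r mul0r; apply => q; rewrite mulrBr; apply/torus_projP.
by rewrite -!right_mul_mapE// ab.
Qed.

Lemma right_mul_map_comp L a b : lattice_units L a -> lattice_units L b ->
  @right_mul_map L (a * b) = @right_mul_map L b \o @right_mul_map L a.
Proof.
move=> aU bU; apply/funext => t; have [q <-] := torus_proj_surj t.
by rewrite /= !right_mul_mapE ?mulrA//; exact: lattice_unitsM.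
Qed.

(** Right multiplications compose in the order opposite to that of the
    quaternions, so an isomorphism from the automorphism group is an
    anti-isomorphism from the lattice units. *)
Lemma torus_aut_isomP L (H : set (quat R)) :
  group_isom (torus_aut L) (fun F G => F \o G) H *%R <->
  exists psi : quat R -> quat R, set_bij (lattice_units L) H psi /\
    forall a b, lattice_units L a -> lattice_units L b -> psi (a * b) = psi b * psi a.
Proof.
split=> [[phi [[phiH phiI phiS] phiM]]|[psi [[psiH psiI psiS] psiM]]].
  have aut a : lattice_units L a -> torus_aut L (@right_mul_map L a).
    by move=> aU; apply/torus_autP; exists a.
  exists (fun a => phi (@right_mul_map L a)); split; last first.
    by move=> a b aU bU; rewrite right_mul_map_comp// phiM//; exact: aut.
  split.
  - by move=> a aU; apply/phiH/aut.
  - move=> a b; rewrite !inE => aU bU /phiI ab.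
    by apply: (right_mul_map_inj aU bU); apply: ab; rewrite inE; exact: aut.
  - move=> h /phiS[F /torus_autP[a aU ->] <-]; by exists a.
pose inv F := xget 0 [set a | lattice_units L a /\ F = @right_mul_map L a].
have invK a : lattice_units L a -> inv (@right_mul_map L a) = a.
  move=> aU; rewrite /inv; case: xgetP => [b _ [bU ab]|/(_ a)]; last by case.
  exact: (right_mul_map_inj bU aU).
exists (psi \o inv); split; last first.
  move=> F G /torus_autP[a aU ->] /torus_autP[b bU ->].
  by rewrite -right_mul_map_comp// /= !invK ?psiM//; exact: lattice_unitsM.
split.
- by move=> F /torus_autP[a aU ->]; rewrite /= invK//; exact: psiH.
- move=> F G; rewrite !inE => /torus_autP[a aU ->] /torus_autP[b bU ->].
  by rewrite /= !invK// => /psiI ->//; rewrite inE.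
- move=> h /psiS[a aU <-]; exists (@right_mul_map L a); last by rewrite /= invK.
  by apply/torus_autP; exists a.
Qed.

(** N contains the Lipschitz lattice, and rounding the coordinates of a point of N
    leaves a remainder of squared norm at most 4 (1/2)^2 = 1. By minimality a
    nonzero remainder has norm exactly 1, so all its coordinates are -1/2. *)
Lemma frame_module_cases (N : set (quat R)) I J :
  imag_units I -> imag_units J -> qdot I J = 0 ->
  (forall x y, N x -> N y -> N (x - y)) -> N 1 ->
  (forall x, N x -> N (x * I)) -> (forall x, N x -> N (x * J)) ->
  (forall x, N x -> x != 0 -> 1 <= normsq x) ->
  N = in_frame I J @` lipschitz_quat \/ N = in_frame I J @` hurwitz_quat.
Proof.
move=> hI hJ hIJ NB N1 NI NJ Nmin.
have Nz : N 0 by rewrite -(subrr 1); exact: NB.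
have NN x : N x -> N (- x) by move=> /(NB _ _ Nz); rewrite sub0r.
have ND x y : N x -> N y -> N (x + y) by move=> Nx /NN Ny; rewrite -[y]opprK; exact: NB.
have NMz x (n : int) : N x -> N (x *~ n).
  move=> Nx; have Nn (k : nat) : N (x *+ k).
    by elim: k => [|k IH]; rewrite ?mulr0n// mulrS; exact: ND.
  by case: n => k; [exact: Nn|rewrite NegzE mulrNz; apply: NN; exact: Nn].
pose e := in_frame I J.
have eD x y : N (e x) -> N (e y) -> N (e (x + y)) by rewrite /e in_frameD; exact: ND.
have eB x y : N (e x) -> N (e y) -> N (e (x - y)).
  by rewrite /e in_frameD in_frameN; exact: NB.
have eMz x (n : int) : N (e x) -> N (e ((n%:~R : R) *: x)).
  by rewrite /e /in_frame !quatZ -!scalerA -!scalerDr scaler_int; exact: NMz.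
have lipN x : lipschitz_quat x -> N (e x).
  move=> [/intrP[a xa] /intrP[b xb] /intrP[c xc] /intrP[d xd]].
  rewrite /e /in_frame xa xb xc xd !scaler_int.
  have NI1 : N I by rewrite -[I]mul1r; exact: NI.
  have NJ1 : N J by rewrite -[J]mul1r; exact: NJ.
  by apply/ND; [apply/ND; [apply/ND|]|]; apply/NMz => //; exact: NJ.
pose h : R := 2^-1.
(* Rounding to [-1/2, 1/2): the half-open choice makes the extreme remainder
   unique. *)
have near_int (t : R) : exists n : int, - h <= t - n%:~R < h.
  exists (Num.floor (t + h)); have := floor_le (t + h); have := floorD1_gt (t + h).
  by rewrite intrD /h; lra.
have half x : N (e x) -> ~ lipschitz_quat x -> lipschitz_quat (x - omega R).
  move=> Nx xnl.
  have [a ha] := near_int (re x); have [b hb] := near_int (im_i x).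
  have [c hc] := near_int (im_j x); have [d hd] := near_int (im_k x).
  pose y : quat R := mkquat a%:~R b%:~R c%:~R d%:~R.
  have ly : lipschitz_quat y by rewrite /lipschitz_quat !mkquatE !intr_int.
  have rN : 1 <= normsq (x - y).
    rewrite -(in_frame_normsq _ hI hJ hIJ); apply: Nmin; first exact: eB (lipN _ ly).
    rewrite -normsq_eq0 in_frame_normsq// normsq_eq0 subr_eq0.
    by apply: contra_notN xnl => /eqP ->.
  have sq (t : R) : - h <= t < h -> t ^+ 2 <= h ^+ 2 /\ (t ^+ 2 = h ^+ 2 -> t = - h).
    by rewrite /h => /andP[t1 t2]; split; nra.
  move: rN; rewrite normsqE !quatD !quatN !mkquatE => rN.
  have [a1 a2] := sq _ ha; have [b1 b2] := sq _ hb.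
  have [c1 c2] := sq _ hc; have [d1 d2] := sq _ hd.
  have h4 : h ^+ 2 + h ^+ 2 + h ^+ 2 + h ^+ 2 = 1 by rewrite /h; field.
  have {}a2 := a2 ltac:(lra); have {}b2 := b2 ltac:(lra).
  have {}c2 := c2 ltac:(lra); have {}d2 := d2 ltac:(lra).
  rewrite /lipschitz_quat !quatD !quatN !mkquatE -/h; split; apply/intrP.
  - by exists (a - 1); rewrite intrB; move: a2; rewrite /h; lra.
  - by exists (b - 1); rewrite intrB; move: b2; rewrite /h; lra.
  - by exists (c - 1); rewrite intrB; move: c2; rewrite /h; lra.
  - by exists (d - 1); rewrite intrB; move: d2; rewrite /h; lra.
have [all_lip|] := pselect (forall x, N (e x) -> lipschitz_quat x).
  left; apply/seteqP; split=> [q Nq|q [x lx <-]]; last exact: lipN.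
  exists (frame_coords I J q); last exact: frame_coordsK.
  by apply: all_lip; rewrite /e frame_coordsK.
move=> /existsNP[x0 /not_implyP[Nx0 x0nl]]; right.
have Nom : N (e (omega R)).
  rewrite -[omega R](subKr x0); apply: eB => //; apply: lipN; exact: half.
have lip_hur x : lipschitz_quat x -> hurwitz_quat x.
  by move=> [x1 x2 x3 x4]; split; rewrite ?rpredB ?rpredM//; exact: (intr_int _ 2).
have om_hur : hurwitz_quat (omega R).
  by rewrite /hurwitz_quat !mkquatE subrr divff ?pnatr_eq0// rpred0 rpred1.
apply/seteqP; split=> [q Nq|q [x [/intrP[t x0E] x1 x2 x3] <-]].
  exists (frame_coords I J q); last exact: frame_coordsK.
  have [/lip_hur//|nl] := pselect (lipschitz_quat (frame_coords I J q)).
  have /lip_hur[y0 y1 y2 y3] : lipschitz_quat (frame_coords I J q - omega R).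
    by apply: half => //; rewrite /e frame_coordsK.
  move: om_hur => [w0 w1 w2 w3].
  rewrite -[frame_coords I J q](subrK (omega R)).
  move: (frame_coords I J q - omega R) y0 y1 y2 y3 => y y0 y1 y2 y3.
  rewrite /hurwitz_quat !quatD mulrDr !opprD.
  by split; [|rewrite addrACA|rewrite addrACA|rewrite addrACA]; apply: rpredD.
rewrite -[x](subrK ((t%:~R : R) *: omega R)); apply: eD; last exact: eMz.
apply: lipN; rewrite /lipschitz_quat !quatD !quatN !quatZ !mkquatE -x0E.
have hE : 2 * re x * 2^-1 = re x by field.
by rewrite hE subrr rpred0; split.
Qed.

End AutomorphismGroup.

(** * Tori with the symmetry of the quaternion group *)

Section QuaternionGroupSymmetry.
Variable R : realType.
Implicit Types (L M : lattice R) (p q x y a b I J : quat R).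

Lemma sqr_eq1_quat x : x * x = 1 -> x = 1 \/ x = -1.
Proof.
move=> xx; have /eqP : (x - 1) * (x + 1) = 0.
  by rewrite mulrDr mulrBl mul1r mulr1 xx addrC addrA subrK subrr.
rewrite qmul_eq0 subr_eq0 addr_eq0 => /orP[] /eqP; [by left|by right].
Qed.

Lemma quat_1_neqN1 : (1 : quat R) <> -1.
Proof. by move=> /(congr1 (@re R)); rewrite quatN re1; lra. Qed.

(** The preimages a and b of I0 and J0 satisfy the relations of the quaternion
    group, where the element of order 2 is -1 because a quaternion with square 1
    is 1 or -1. *)
Lemma anti_isom_anticommuting_units L I0 J0 (psi : quat R -> quat R) :
  imag_units I0 -> imag_units J0 -> qdot I0 J0 = 0 ->
  set_bij (lattice_units L) (twoD4 I0 J0) psi ->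
  (forall a b, lattice_units L a -> lattice_units L b -> psi (a * b) = psi b * psi a) ->
  (exists a b, [/\ lattice_units L a, lattice_units L b, a * a = -1, b * b = -1 &
    b * a = - (a * b)]) /\
  (forall u, lattice_units L u -> u * u * (u * u) = 1).
Proof.
move=> hI hJ hIJ [psiH psiI psiS] psiM.
have ii := imag_unit_sqr hI; have jj := imag_unit_sqr hJ.
have inj a b : lattice_units L a -> lattice_units L b -> psi a = psi b -> a = b.
  by move=> aU bU; apply: psiI; rewrite inE.
have U1 := lattice_units1 L.
have psi1 : psi 1 = 1.
  have h : psi 1 * (psi 1 - 1) = 0 by rewrite mulrBr -psiM// !mulr1 subrr.
  have /eqP := h; rewrite qmul_eq0 subr_eq0 => /orP[/eqP p0|/eqP//].
  by have [] := twoD4_sqr hI hJ hIJ (psiH _ U1); rewrite p0 mul0r => /esym/eqP;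
    rewrite ?oppr_eq0 oner_eq0.
have u4 u : lattice_units L u -> u * u * (u * u) = 1.
  move=> uU; apply: inj => //; first by do ![apply: lattice_unitsM].
  rewrite psi1 !psiM//; try exact: lattice_unitsM.
  by case: (twoD4_sqr hI hJ hIJ (psiH _ uU)) => ->; rewrite ?mulrNN mulr1.
split=> //.
have [a aU aI] : (psi @` lattice_units L) I0 by apply: psiS; rewrite /twoD4 /=; tauto.
have [b bU bJ] : (psi @` lattice_units L) J0 by apply: psiS; rewrite /twoD4 /=; tauto.
have aa : a * a = -1.
  have [h|//] := sqr_eq1_quat (u4 _ aU).
  by case: quat_1_neqN1; rewrite -ii -aI -psiM// h psi1.
have bb : b * b = -1.
  by rewrite -aa; apply: inj; rewrite ?psiM ?bJ ?aI ?ii ?jj//; exact: lattice_unitsM.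
exists a, b; split=> //.
rewrite -mulN1r -aa; apply: inj; [exact: lattice_unitsM|by do ![apply: lattice_unitsM]|].
rewrite !psiM ?aI ?bJ ?ii ?(imag_unit_anticomm hI hJ hIJ) ?mulrN1 ?opprK//.
all: exact: lattice_unitsM.
Qed.

Lemma conj_mulE m p q : m != 0 ->
  (m * p * qinv m) * (m * q * qinv m) = m * (p * q) * qinv m.
Proof. by move=> m0; rewrite !mulrA -[_ * qinv m * m]mulrA qinv_mul// mulr1. Qed.

Lemma conj_imag_unit m a : m != 0 -> a * a = -1 -> imag_units (m * a * qinv m).
Proof.
move=> m0 aa; rewrite /imag_units /= expr2 conj_mulE// aa.
by rewrite mulrN1 mulNr qmul_inv.
Qed.

(** After scaling by a shortest vector m the lattice is Lipschitz or Hurwitz; in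
    the Hurwitz case the conjugate by m of (1 + I + J + I J) / 2 would be a unit u
    of L with u^2 = u - 1, so that u^4 = - u; then u^4 = 1 would give u = -1,
    which does not satisfy u^2 = u - 1. *)
Lemma anticommuting_units_modulus L a b :
  lattice_units L a -> lattice_units L b -> a * a = -1 -> b * b = -1 ->
  b * a = - (a * b) -> (forall u, lattice_units L u -> u * u * (u * u) = 1) ->
  exists I J, [/\ imag_units I, imag_units J, qdot J I = 0 & is_modulus L (I, J, J * I)].
Proof.
move=> [aN aU] [bN bU] aa bb ba u4.
have [m [Lm m0 mmin]] := lattice_min_vector L.
pose I := m * a * qinv m; pose J := m * b * qinv m.
have hI : imag_units I by exact: conj_imag_unit.
have hJ : imag_units J by exact: conj_imag_unit.
have hIJ : qdot I J = 0.
  by apply: anticomm_orthogonal => //; rewrite /I /J !conj_mulE// ba mulrN mulNr.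
exists I, J; split=> //; first by rewrite qdotC.
split; first exact: frame_moduli.
pose N : set (quat R) := [set q | lattice_set L (q * m)].
have NB x y : N x -> N y -> N (x - y).
  by rewrite /N /= mulrBl; exact: latticeB.
have N1 : N 1 by rewrite /N /= mul1r.
have NI x : N x -> N (x * I).
  by rewrite /N /= /I !mulrA -[_ * qinv m * m]mulrA qinv_mul// mulr1 aU.
have NJ x : N x -> N (x * J).
  by rewrite /N /= /J !mulrA -[_ * qinv m * m]mulrA qinv_mul// mulr1 bU.
have Nmin x : N x -> x != 0 -> 1 <= normsq x.
  move=> Nx x0; have := mmin _ Nx; rewrite qmul_eq0 (negPf x0) (negPf m0) => /(_ isT).
  by rewrite normsqM ler_pMl// lt_def normsq_ge0 normsq_eq0 m0.
have [NL|NH] := frame_module_cases hI hJ hIJ NB N1 NI NJ Nmin.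
  have mem : exists v, lattice_basis (zspan (basis1 (I, J, J * I))) v.
    by exists (basis1 (I, J, J * I)); split=> //; exact: basis1_frame_free.
  exists (Lattice mem); split=> //.
  have im0 : qinv m != 0.
    apply/eqP => h; have /esym/eqP := qinv_mul m0.
    by rewrite h mul0r oner_eq0.
  apply: (lattice_torus_equiv im0) => q /=.
  rewrite zspan_basis1_frame// -NL /N /=; split=> [Lq|[l Ll ->]].
    by exists (q * m) => //; rewrite -mulrA qmul_inv// mulr1.
  by rewrite -mulrA qinv_mul// mulr1.
pose w := in_frame I J (omega R); pose w' := in_frame I J (qconj (omega R)).
have omN : normsq (omega R) = 1 by rewrite normsqE !mkquatE; field.
have ww' : w * w' = 1.
  by rewrite /w /w' -in_frameM// mul_qconj omN scale1r in_frame1.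
have w'w : w' * w = 1.
  by rewrite /w /w' -in_frameM// qconj_mul omN scale1r in_frame1.
have Nw q : N q -> N (q * w).
  rewrite NH => -[x hx <-]; exists (x * omega R); first exact: hurwitz_mul_omega.
  by rewrite in_frameM.
have Nw' q : N q -> N (q * w').
  rewrite NH => -[x hx <-]; exists (x * qconj (omega R)); first exact: hurwitz_mul_omegaV.
  by rewrite in_frameM.
pose u := qinv m * w * m.
have uU : lattice_units L u.
  split.
    have := normsqM (qinv m) m; rewrite qinv_mul// normsq1 => mN.
    by rewrite /u !normsqM in_frame_normsq// omN mulr1 -mN.
  move=> q; have qE : q = q * qinv m * m by rewrite -mulrA qinv_mul// mulr1.
  have qu : q * u = q * qinv m * w * m by rewrite /u !mulrA.
  rewrite {2}qE qu -[lattice_set L (_ * w * m)]/(N _) -[lattice_set L _]/(N _).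
  by split=> [/Nw'|/Nw//]; rewrite -mulrA ww' mulr1.
exfalso; have uu : u * u = u - 1.
  have w2 : w * w = w - 1.
    by rewrite /w -in_frameM// omega_sqr in_frameD in_frameN in_frame1.
  rewrite /u !mulrA -[_ * m * qinv m]mulrA qmul_inv// mulr1 -[_ * w * w]mulrA w2.
  by rewrite mulrBr mulrBl mulr1 qinv_mul.
have := u4 _ uU.
have -> : u * u * (u * u) = - u.
  rewrite uu mulrBl mulrBr mul1r mulr1 uu [u - 1 - u]addrAC subrr add0r opprB.
  by rewrite addrA addNr add0r.
move=> /eqP; rewrite eqr_oppLR => /eqP uN.
move: uu; rewrite uN mulrNN mulr1 => /(congr1 (@re R)).
by rewrite quatD quatN re1; clear; lra.
Qed.

(** With M = L c, conjugation by c identifies the units of L with those of M, that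
    is with the integral x of norm 1 through the frame (I, J); reading x in the
    frame (I0, J0) is multiplicative, and composing with x |-> conjugate of x
    reverses products. *)
Lemma modulus_anti_isom L I0 J0 I J :
  imag_units I0 -> imag_units J0 -> qdot I0 J0 = 0 ->
  imag_units I -> imag_units J -> qdot I J = 0 -> is_modulus L (I, J, J * I) ->
  exists psi : quat R -> quat R, set_bij (lattice_units L) (twoD4 I0 J0) psi /\
    forall a b, lattice_units L a -> lattice_units L b -> psi (a * b) = psi b * psi a.
Proof.
move=> hI0 hJ0 hIJ0 hI hJ hIJ [_ [M [ME /torus_equiv_lattice[c c0 Mc]]]].
have {}ME : lattice_set M = in_frame I J @` lipschitz_quat.
  by rewrite ME zspan_basis1_frame.
pose S : set (quat R) := [set x | lipschitz_quat x /\ normsq x = 1].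
pose lift x := c * in_frame I J x * qinv c.
pose coords a := frame_coords I J (qinv c * a * c).
have liftK : cancel lift coords.
  move=> x; rewrite /coords /lift !mulrA qinv_mul// mul1r -mulrA qinv_mul// mulr1.
  exact: in_frameK.
have coordsK : cancel coords lift.
  move=> a; rewrite /coords /lift frame_coordsK// !mulrA qmul_inv// mul1r.
  by rewrite -mulrA qmul_inv// mulr1.
have liftM x y : lift (x * y) = lift x * lift y.
  by rewrite /lift conj_mulE// in_frameM.
have ccN : normsq c * normsq (qinv c) = 1 by rewrite -normsqM qmul_inv// normsq1.
have liftN x : normsq (lift x) = normsq x.
  by rewrite /lift !normsqM in_frame_normsq// mulrAC ccN mul1r.
have LM q : lattice_set L q <-> lattice_set M (q * c).
  split=> [Lq|/Mc[l Ll /eqP]]; first by apply/Mc; exists q.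
  by rewrite -subr_eq0 -mulrBl qmul_eq0 (negPf c0) orbF subr_eq0 => /eqP ->.
have Mlip x y : lipschitz_quat y -> lattice_set M x -> lattice_set M (x * in_frame I J y).
  rewrite ME => ly [x' lx' <-]; exists (x' * y); first exact: lipschitzM.
  by rewrite in_frameM.
have liftU x : S x -> lattice_units L (lift x).
  move=> [lx xN]; split; first by rewrite liftN.
  move=> q; rewrite !LM /lift !mulrA -[_ * qinv c * c]mulrA qinv_mul// mulr1.
  split=> [|]; last exact: Mlip.
  move=> /(Mlip _ _ (lipschitz_conj lx)).
  by rewrite -mulrA -in_frameM// mul_qconj xN scale1r in_frame1 mulr1.
have coordsS a : lattice_units L a -> S (coords a).
  move=> [aN aL]; rewrite -[a]coordsK in aN aL.
  split; last by rewrite -liftN.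
  have : lattice_set M (in_frame I J (coords a)).
    have : lattice_set M 1.
      rewrite ME; exists 1; last exact: in_frame1.
      by rewrite /lipschitz_quat !re1; split; rewrite ?rpred0 ?rpred1.
    have -> : (1 : quat R) = qinv c * c by rewrite qinv_mul.
    rewrite -LM -aL LM /lift.
    by rewrite !mulrA -[_ * qinv c * c]mulrA !qinv_mul// mul1r mulr1.
  by rewrite ME => -[x lx /(can_inj (in_frameK hI hJ hIJ)) <-].
have coordsM a b : coords (a * b) = coords a * coords b.
  by apply: (can_inj liftK); rewrite liftM !coordsK.
have conjS x : S x -> S (qconj x).
  by move=> [lx xN]; split; [exact: lipschitz_conj|rewrite normsq_conj].
exists (fun a => in_frame I0 J0 (qconj (coords a))); split; last first.
  by move=> a b aU bU; rewrite coordsM qconjM in_frameM.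
rewrite twoD4_frame; split.
- by move=> a aU; exists (qconj (coords a)) => //; exact/conjS/coordsS.
- move=> a b _ _ /(can_inj (in_frameK hI0 hJ0 hIJ0)) /(can_inj (@qconjK R)).
  exact: (can_inj coordsK).
- move=> q [x Sx <-]; exists (lift (qconj x)); first exact/liftU/conjS.
  by rewrite liftK qconjK.
Qed.

End QuaternionGroupSymmetry.

Theorem proposition8p15 (R : realType) (L : lattice R) (I0 J0 : quat R)
    (hI0 : imag_units I0) (hJ0 : imag_units J0) (hIJ0 : qdot I0 J0 = 0) :
  group_isom (torus_aut L) (fun F G => F \o G) (twoD4 I0 J0) *%R <->
  exists I J : quat R,
    [/\ imag_units I, imag_units J, qdot J I = 0 & is_modulus L (I, J, J * I)].
Proof.
rewrite torus_aut_isomP; split=> [[psi [psiB psiM]]|[I [J [hI hJ hJI mod]]]].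
  have [[a [b [aU bU aa bb ba]]] u4] :=
    anti_isom_anticommuting_units hI0 hJ0 hIJ0 psiB psiM.
  exact: anticommuting_units_modulus aU bU aa bb ba u4.
by apply: modulus_anti_isom mod => //; rewrite qdotC.
Qed.
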